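(* Let $R$ be a Noetherian semi-local ring such that $R_M$ is a one-dimensional Cohen-Macaulay local ring for every maximal ideal $M$ of $R$. Suppose that $R$ is an Arf ring. Then, for every finite subgroup $G$ of the automorphism group $\operatorname{Aut} R$ such that the order of $G$ is invertible in $R$, the invariant subring $R^G$ is an Arf ring.
   Context: For a commutative ring $A$, $Q(A)$ denotes its total ring of fractions. A Noetherian semi-local ring $A$ such that $A_M$ is a one-dimensional Cohen-Macaulay local ring for every maximal ideal $M$ is called an Arf ring if: (1) every integrally closed ideal $I$ of $A$ containing a non-zerodivisor on $A$ has a principal reduction, i.e., $I^{n+1}=aI^n$ for some $n\ge 0$ and $a\in I$; and (2) if $x,y,z\in A$ are such that $x$ is a non-zerodivisor on $A$ and $y/x, z/x\in Q(A)$ are integral over $A$, then $yz/x\in A$. (Being an Arf ring includes the requirement that the ring is Noetherian, semi-local, with all localizations at maximal ideals one-dimensional Cohen-Macaulay.) *)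

(* Defs.v *)
From HB Require Import structures.
From mathcomp Require Import all_boot all_order all_algebra finmap.
From mathcomp Require Import all_classical.
From mathcomp Require Import ring.

Set Implicit Arguments.
Unset Strict Implicit.
Unset Printing Implicit Defensive.

Import GRing.Theory.

Local Open Scope ring_scope.
Local Open Scope classical_set_scope.
Local Open Scope quotient_scope.

Section Ideals.
Variable A : comNzRingType.
Implicit Types (I J M P : set A) (x y a : A).

Definition ideal I : Prop :=
  I 0 /\ forall a x y, I x -> I y -> I (a * x + y).

Definition prime_ideal P : Prop :=
  [/\ ideal P, ~ P 1 & forall x y, P (x * y) -> P x \/ P y].

Definition maximal_ideal M : Prop :=
  [/\ ideal M, ~ M 1 &
      forall J, ideal J -> M `<=` J -> J = M \/ J = setT].

Definition ideal_gen (X : set A) : set A := smallest ideal X.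

Definition ideal_mul I J : set A := ideal_gen [set x * y | x in I & y in J].

Definition ideal_pow I (n : nat) : set A := iter n (ideal_mul I) setT.

Definition integral_over_ideal I x : Prop :=
  exists (n : nat) (a : nat -> A),
    [/\ (0 < n)%N, forall i, (0 < i <= n)%N -> ideal_pow I i (a i) &
        x ^+ n + \sum_(1 <= i < n.+1) a i * x ^+ (n - i) = 0].

Definition integrally_closed_ideal I : Prop :=
  ideal I /\ forall x, integral_over_ideal I x -> I x.

Definition has_principal_reduction I : Prop :=
  exists (n : nat) a,
    I a /\ ideal_pow I n.+1 = [set a * x | x in ideal_pow I n].

Lemma maximal_prime M : maximal_ideal M -> prime_ideal M.
Proof.
move=> [[M0 Ml] M1 Mmax]; split=> // x y Mxy.
have [Mx|nMx] := pselect (M x); [by left | right].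
pose J := [set z | exists m r, M m /\ z = m + r * x].
have iJ : ideal J.
  split=> [|a z t [m [r [Mm ->]]] [m' [r' [Mm' ->]]]].
    by exists 0, 0; split=> //; ring.
  by exists (a * m + m'), (a * r + r'); split; [exact: Ml | ring].
have MJ : M `<=` J by move=> m Mm; exists m, 0; split=> //; ring.
have [JM|JT] := Mmax J iJ MJ.
  by case: nMx; rewrite -JM; exists 0, 1; split=> //; ring.
have [m [r [Mm e]]] : J 1 by rewrite JT.
have -> : y = y * m + (r * (x * y) + 0).
  by rewrite -[LHS]mulr1 e; ring.
by apply: (Ml) => //; exact: Ml.
Qed.

End Ideals.

(* 0 is excluded so that the localization is again a nonzero ring. *)
Record mulset (A : comNzRingType) := Mulset {
  mulset_set :> A -> Prop;
  mulset0 : ~ mulset_set 0;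
  mulset1 : mulset_set 1;
  mulsetM : forall x y, mulset_set x -> mulset_set y -> mulset_set (x * y)
}.

Module Localization.
Section Localization.
Variables (A : comNzRingType) (S : mulset A).

Record ratio := Ratio { num : A; den : A; denP : S den }.

HB.instance Definition _ := gen_eqMixin ratio.
HB.instance Definition _ := gen_choiceMixin ratio.

Definition ratio_eq (r s : ratio) : Prop :=
  exists u, S u /\ u * (num r * den s) = u * (num s * den r).

Definition eqr (r s : ratio) : bool := `[< ratio_eq r s >].

Fact eqr_refl : reflexive eqr.
Proof. by move=> r; apply/asboolP; exists 1; split=> //; exact: mulset1. Qed.

Fact eqr_sym : symmetric eqr.
Proof.
by move=> r s; apply/asboolP/asboolP=> -[u [Su e]]; exists u; split.
Qed.

Fact eqr_trans : transitive eqr.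
Proof.
move=> s r t /asboolP[u [Su e]] /asboolP[v [Sv f]]; apply/asboolP.
exists (u * v * den s); split; first by do 2?apply: mulsetM => //; exact: denP.
have -> : u * v * den s * (num r * den t)
   = v * den t * (u * (num r * den s)) by ring.
rewrite e.
have -> : v * den t * (u * (num s * den r))
   = u * den r * (v * (num s * den t)) by ring.
by rewrite f; ring.
Qed.

Canonical eqr_equiv := EquivRel eqr eqr_refl eqr_sym eqr_trans.

Definition type := {eq_quot eqr}.

HB.instance Definition _ : EqQuotient _ eqr type := EqQuotient.on type.
HB.instance Definition _ := Choice.on type.

Definition frac (x s : A) (Ss : S s) : type := \pi_type (Ratio x Ss).

Lemma frac_eq x s (Ss : S s) y t (St : S t) :
  frac x Ss = frac y St <-> exists u, S u /\ u * (x * t) = u * (y * s).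
Proof.
have -> : (frac x Ss = frac y St) = (eqr (Ratio x Ss) (Ratio y St)).
  by apply/propext; split=> [/eqP|?]; rewrite /frac; [|apply/eqP]; rewrite eqmodE.
by split=> /asboolP.
Qed.

Lemma fracP (z : type) : exists x s (Ss : S s), z = frac x Ss.
Proof.
by elim/quotW: z => -[x s Ss]; exists x, s, Ss.
Qed.

Lemma repr_frac x s (Ss : S s) : ratio_eq (repr (frac x Ss)) (Ratio x Ss).
Proof.
by move: (reprK (frac x Ss)) => /eqP; rewrite /frac eqmodE => /asboolP.
Qed.

Definition add (z w : type) : type :=
  frac (num (repr z) * den (repr w) + num (repr w) * den (repr z))
       (mulsetM (denP (repr z)) (denP (repr w))).
Definition opp (z : type) : type := frac (- num (repr z)) (denP (repr z)).
Definition mul (z w : type) : type :=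
  frac (num (repr z) * num (repr w))
       (mulsetM (denP (repr z)) (denP (repr w))).

Lemma add_frac x s (Ss : S s) y t (St : S t) :
  add (frac x Ss) (frac y St) = frac (x * t + y * s) (mulsetM Ss St).
Proof.
apply/frac_eq.
have [u [Su /= e]] := repr_frac x Ss; have [v [Sv /= f]] := repr_frac y St.
move: (repr _) (repr _) e f => [c d Sd] [a b Sb] /= e f.
exists (u * v); split; first exact: mulsetM.
have -> : u * v * ((a * d + c * b) * (s * t))
  = v * d * t * (u * (a * s)) + u * b * s * (v * (c * t)) by ring.
by rewrite e f; ring.
Qed.

Lemma opp_frac x s (Ss : S s) : opp (frac x Ss) = frac (- x) Ss.
Proof.
apply/frac_eq; have [u [Su /= e]] := repr_frac x Ss.
by exists u; split=> //; rewrite !mulNr !mulrN e.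
Qed.

Lemma mul_frac x s (Ss : S s) y t (St : S t) :
  mul (frac x Ss) (frac y St) = frac (x * y) (mulsetM Ss St).
Proof.
apply/frac_eq.
have [u [Su /= e]] := repr_frac x Ss; have [v [Sv /= f]] := repr_frac y St.
move: (repr _) (repr _) e f => [c d Sd] [a b Sb] /= e f.
exists (u * v); split; first exact: mulsetM.
have -> : u * v * (a * c * (s * t)) = (u * (a * s)) * (v * (c * t)) by ring.
by rewrite e f; ring.
Qed.

Lemma frac_eq1 x s (Ss : S s) y t (St : S t) :
  x * t = y * s -> frac x Ss = frac y St.
Proof. by move=> e; apply/frac_eq; exists 1; split; [exact: mulset1|rewrite e]. Qed.

Definition zero : type := frac 0 (mulset1 S).
Definition one : type := frac 1 (mulset1 S).

Fact addA : associative add.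
Proof.
move=> z w v; have [x [s [Ss ->]]] := fracP z; have [y [t [St ->]]] := fracP w.
have [x' [r [Sr ->]]] := fracP v.
by rewrite !add_frac; apply: frac_eq1; ring.
Qed.

Fact addC : commutative add.
Proof.
move=> z w; have [x [s [Ss ->]]] := fracP z; have [y [t [St ->]]] := fracP w.
by rewrite !add_frac; apply: frac_eq1; ring.
Qed.

Fact add0 : left_id zero add.
Proof.
move=> z; have [x [s [Ss ->]]] := fracP z.
by rewrite add_frac; apply: frac_eq1; ring.
Qed.

Fact addN : left_inverse zero opp add.
Proof.
move=> z; have [x [s [Ss ->]]] := fracP z.
by rewrite opp_frac add_frac; apply: frac_eq1; ring.
Qed.

HB.instance Definition _ := GRing.isZmodule.Build type addA addC add0 addN.

Fact mulA : associative mul.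
Proof.
move=> z w v; have [x [s [Ss ->]]] := fracP z; have [y [t [St ->]]] := fracP w.
have [x' [r [Sr ->]]] := fracP v.
by rewrite !mul_frac; apply: frac_eq1; ring.
Qed.

Fact mulC : commutative mul.
Proof.
move=> z w; have [x [s [Ss ->]]] := fracP z; have [y [t [St ->]]] := fracP w.
by rewrite !mul_frac; apply: frac_eq1; ring.
Qed.

Fact mul1 : left_id one mul.
Proof.
move=> z; have [x [s [Ss ->]]] := fracP z.
by rewrite mul_frac; apply: frac_eq1; ring.
Qed.

Fact mulD : left_distributive mul add.
Proof.
move=> z w v; have [x [s [Ss ->]]] := fracP z; have [y [t [St ->]]] := fracP w.
have [x' [r [Sr ->]]] := fracP v.
by rewrite !(add_frac, mul_frac); apply: frac_eq1; ring.
Qed.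

Fact one_neq0 : one != zero.
Proof.
apply/eqP => /frac_eq[u [Su]]; rewrite !mulr1 mulr0 => u0.
by apply: (@mulset0 _ S); rewrite -u0.
Qed.

HB.instance Definition _ :=
  GRing.Zmodule_isComNzRing.Build type mulA mulC mul1 mulD one_neq0.

Definition tofrac (x : A) : type := frac x (mulset1 S).

Fact tofrac_is_zmod_morphism : zmod_morphism tofrac.
Proof.
move=> x y; have -> : tofrac x - tofrac y = add (tofrac x) (opp (tofrac y)) by [].
by rewrite /tofrac opp_frac add_frac; apply: frac_eq1; ring.
Qed.

Fact tofrac_is_monoid_morphism : monoid_morphism tofrac.
Proof.
split=> // x y; have -> : tofrac x * tofrac y = mul (tofrac x) (tofrac y) by [].
by rewrite /tofrac mul_frac; apply: frac_eq1; ring.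
Qed.

HB.instance Definition _ :=
  GRing.isZmodMorphism.Build A type tofrac tofrac_is_zmod_morphism.
HB.instance Definition _ :=
  GRing.isMonoidMorphism.Build A type tofrac tofrac_is_monoid_morphism.

End Localization.
End Localization.
HB.export Localization.

Notation localization := Localization.type.
(* @frac A S x s Ss is the fraction x / s. *)
Notation frac := Localization.frac.
Notation tofrac := Localization.tofrac.

Section ComplPrime.
Variables (A : comNzRingType) (P : set A) (hP : prime_ideal P).

Fact compl_prime0 : ~ (~` P) 0.
Proof. by apply; case: hP => -[]. Qed.

Fact compl_prime1 : (~` P) 1.
Proof. by case: hP. Qed.

Fact compl_primeM x y : (~` P) x -> (~` P) y -> (~` P) (x * y).
Proof. by case: hP => _ _ H nx ny /H[]. Qed.

Definition compl_prime : mulset A :=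
  Mulset compl_prime0 compl_prime1 compl_primeM.

End ComplPrime.

Definition localization_at (A : comNzRingType) (P : set A)
    (hP : prime_ideal P) : comNzRingType :=
  localization (compl_prime hP).

Section TotalFractions.
Variable A : comNzRingType.

Fact nzd0 : ~ [set x : A | GRing.lreg x] 0.
Proof.
by move=> /(_ 1 0 (etrans (mul0r _) (esym (mul0r _))))/eqP; rewrite oner_eq0.
Qed.

Fact nzd1 : [set x : A | GRing.lreg x] 1.
Proof. exact: lreg1. Qed.

Fact nzdM (x y : A) : [set x : A | GRing.lreg x] x ->
  [set x : A | GRing.lreg x] y -> [set x : A | GRing.lreg x] (x * y).
Proof. exact: lregM. Qed.

(* In a commutative ring, GRing.lreg is being a non-zerodivisor. *)
Definition nzd : mulset A := Mulset nzd0 nzd1 nzdM.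

Definition total_fractions : comNzRingType := localization nzd.

Definition integral_over_base (q : total_fractions) : Prop :=
  integralOver (@tofrac A nzd) q.

Definition in_base (q : total_fractions) : Prop := range (@tofrac A nzd) q.

End TotalFractions.

Section Rings.
Variable A : comNzRingType.

Definition noetherian : Prop :=
  forall I : set A, ideal I -> exists s : seq A, I = ideal_gen [set` s].

Definition semilocal : Prop := finite_set [set M : set A | maximal_ideal M].

Definition prime_chain (n : nat) (P : 'I_n.+1 -> set A) : Prop :=
  (forall i, prime_ideal (P i)) /\
  (forall i j : 'I_n.+1, (i < j)%N -> P i `<` P j).

Definition has_krull_dim (n : nat) : Prop :=
  (exists P, @prime_chain n P) /\
  (forall m P, @prime_chain m P -> (m <= n)%N).

(* Each s`_i is a non-zerodivisor modulo (s_0, .., s_(i-1)), and A / (s) is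
   nonzero. *)
Definition regular_sequence (s : seq A) : Prop :=
  ~ ideal_gen [set` s] 1 /\
  forall i, (i < size s)%N -> forall y,
    ideal_gen [set` take i s] (s`_i * y) -> ideal_gen [set` take i s] y.

(* Depth of a local ring with maximal ideal M: the largest length of a regular
   sequence in M. *)
Definition has_depth (M : set A) (n : nat) : Prop :=
  (exists s, [/\ regular_sequence s, [set` s] `<=` M & size s = n]) /\
  (forall s, regular_sequence s -> [set` s] `<=` M -> (size s <= n)%N).

Definition cohen_macaulay_local : Prop :=
  noetherian /\
  exists M : set A, (forall N, maximal_ideal N <-> N = M) /\
  exists n, has_krull_dim n /\ has_depth M n.

End Rings.

Definition one_dim_cm_semilocal (A : comNzRingType) : Prop :=
  [/\ noetherian A, semilocal A &
      forall (M : set A) (hM : maximal_ideal M),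
        let AM := localization_at (maximal_prime hM) in
        has_krull_dim AM 1 /\ cohen_macaulay_local AM].

Definition arf_ring (A : comNzRingType) : Prop :=
  [/\ one_dim_cm_semilocal A,
      forall I : set A, integrally_closed_ideal I ->
        (exists x, I x /\ nzd A x) -> has_principal_reduction I &
      forall (x y z : A) (hx : nzd A x),
        integral_over_base (frac y hx) -> integral_over_base (frac z hx) ->
        in_base (frac (y * z) hx)].

Record ring_aut (R : comNzRingType) := RingAut {
  aut_fun :> R -> R;
  aut_zmod : zmod_morphism aut_fun;
  aut_monoid : monoid_morphism aut_fun;
  aut_bij : bijective aut_fun
}.

Section RingAut.
Variable R : comNzRingType.
Implicit Types g h : ring_aut R.

HB.instance Definition _ g :=
  GRing.isZmodMorphism.Build R R (aut_fun g) (aut_zmod g).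
HB.instance Definition _ g :=
  GRing.isMonoidMorphism.Build R R (aut_fun g) (aut_monoid g).

HB.instance Definition _ := gen_eqMixin (ring_aut R).
HB.instance Definition _ := gen_choiceMixin (ring_aut R).

Lemma ring_autP g h : (forall x, g x = h x) -> g = h.
Proof.
case: g h => [f a b c] [f' a' b' c'] /= /funext e.
case: f' / e a' b' c' => a' b' c'.
by rewrite (Prop_irrelevance a a') (Prop_irrelevance b b')
  (Prop_irrelevance c c').
Qed.

Definition aut_one : ring_aut R :=
  @RingAut R idfun (fun _ _ => erefl) (erefl, fun _ _ => erefl)
    (inv_bij (fun _ => erefl)).

Fact aut_mul_zmod g h : zmod_morphism (g \o h).
Proof. by move=> x y /=; rewrite !rmorphB. Qed.

Fact aut_mul_monoid g h : monoid_morphism (g \o h).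
Proof. by split=> [|x y] /=; rewrite ?rmorph1 ?rmorphM. Qed.

Definition aut_mul g h : ring_aut R :=
  RingAut (aut_mul_zmod g h) (aut_mul_monoid g h)
    (bij_comp (aut_bij g) (aut_bij h)).

Definition aut_inv_fun g : R -> R :=
  projT1 (cid (let: Bijective f fK gK := aut_bij g in
    ex_intro (fun f => cancel g f /\ cancel f g) f (conj fK gK))).

Fact aut_funK g : cancel g (aut_inv_fun g).
Proof. by rewrite /aut_inv_fun; case: cid => f []. Qed.

Fact aut_inv_funK g : cancel (aut_inv_fun g) g.
Proof. by rewrite /aut_inv_fun; case: cid => f []. Qed.

Fact aut_inv_zmod g : zmod_morphism (aut_inv_fun g).
Proof.
by move=> x y; apply: (can_inj (aut_funK g)); rewrite rmorphB /= !aut_inv_funK.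
Qed.

Fact aut_inv_monoid g : monoid_morphism (aut_inv_fun g).
Proof.
split=> [|x y]; apply: (can_inj (aut_funK g)).
  by rewrite aut_inv_funK rmorph1.
by rewrite rmorphM /= !aut_inv_funK.
Qed.

Definition aut_inv g : ring_aut R :=
  RingAut (aut_inv_zmod g) (aut_inv_monoid g)
    (Bijective (aut_inv_funK g) (aut_funK g)).

Fact aut_mulA : associative aut_mul.
Proof. by move=> g h k; apply: ring_autP. Qed.

Fact aut_mul1 : left_id aut_one aut_mul.
Proof. by move=> g; apply: ring_autP. Qed.

Fact aut_mulr1 : right_id aut_one aut_mul.
Proof. by move=> g; apply: ring_autP. Qed.

Fact aut_mulV : left_inverse aut_one aut_inv aut_mul.
Proof. by move=> g; apply: ring_autP => x /=; exact: aut_funK. Qed.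

Fact aut_mulrV : right_inverse aut_one aut_inv aut_mul.
Proof. by move=> g; apply: ring_autP => x /=; exact: aut_inv_funK. Qed.

HB.instance Definition _ := isGroup.Build (ring_aut R)
  aut_mulA aut_mul1 aut_mulr1 aut_mulV aut_mulrV.

Definition finite_subgroup (G : set (ring_aut R)) : Prop :=
  [/\ group_closed (mem G) & finite_set G].

(* Cardinality of a finite set; fset_set G is junk if G is infinite. *)
Definition group_order (G : set (ring_aut R)) : nat := #|` fset_set G|.

Definition invertible (a : R) : Prop := exists b, b * a = 1.

Definition invariant (G : set (ring_aut R)) : {pred R} :=
  fun x => `[< forall g, G g -> g x = x >].

Fact invariant_subring G : subring_closed (invariant G).
Proof.
split=> [|x y /asboolP hx /asboolP hy|x y /asboolP hx /asboolP hy];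
  apply/asboolP => g Gg.
- exact: rmorph1.
- by rewrite rmorphB /= hx ?hy.
- by rewrite rmorphM /= hx ?hy.
Qed.

Record invariant_ring (G : set (ring_aut R)) := InvariantRing {
  invariant_val :> R;
  invariant_valP : invariant_val \in invariant G
}.

Section InvariantRing.
Variable G : set (ring_aut R).
HB.instance Definition _ := [isSub for @invariant_val G].
HB.instance Definition _ := [Choice of invariant_ring G by <:].
HB.instance Definition _ :=
  GRing.SubChoice_isSubComNzRing.Build R (invariant G) (invariant_ring G)
    (invariant_subring G).
End InvariantRing.

End RingAut.

(* Main.v *)
From HB Require Import structures.
From mathcomp Require Import all_boot all_order all_algebra finmap.
From mathcomp Require Import all_classical.
From mathcomp Require Import ring zify.
Require Import Defs.

Set Implicit Arguments.
Unset Strict Implicit.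
Unset Printing Implicit Defensive.

Import GRing.Theory.

Local Open Scope ring_scope.
Local Open Scope classical_set_scope.

(** Let S = R^G, let n = |G| and let rho = (1/n) sum_g g be the Reynolds operator,
    an S-linear retraction of R onto S.  It gives IR meet S = I for every ideal I
    of S, and it lets equations over R with unknowns in S be averaged into
    equations over S.

    The condition on localizations.  A Noetherian semi-local ring is locally
    one-dimensional Cohen-Macaulay exactly when it has no chain of three primes
    and has a non-zerodivisor in its Jacobson radical
    ([one_dim_cm_semilocalP]).  Noetherianity descends to S since IR meets S in I.
    A norm computation shows that a chain of primes of S lifts to R
    ([exists_prime_over]), whence S is semi-local and has no chain of three
    primes.  The norm of a non-zerodivisor in the Jacobson radical of R is one in
    that of S.

    The condition on yz/x.  A non-zerodivisor x of S remains one in R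
    ([nzd_val]), so yz = x r with r in R by the hypothesis on R, and then
    yz = x rho(r).

    Principal reductions.  Let I be an integrally closed ideal of S that contains
    a non-zerodivisor, and J the integral closure of IR.  Then J meets S in I.
    Since R is Arf, J^(n+1) = a J^n for some a in J; the fractions j / a are
    integral over R, so the condition on yz/x improves this to J^2 = a J
    ([arf_stable]).  Thus B = J / a is a ring, integral over R.  What is missing is
    an element s of I for which s / a is a unit of B, for then J^2 = s J and
    I^2 = s I.  Each maximal ideal of B misses s / a for some s in I, because a is
    integral over IR, and the point is to find one s for all of them.  Modulo an
    invariant non-zerodivisor t of the Jacobson radical, B is zero-dimensional, so
    an s1 in I splits the maximal ideals into two parts by a function that is 1
    where s1 vanishes and 0 elsewhere.  Multiply it by a second element s2 of I
    and average over G: both parts are stable under G, so the values at the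
    maximal ideals do not change, and adding the result to s1 gives an element of
    I that vanishes only where s1 and s2 both do ([combine_generators]). *)

(** * Ideals, primes and dimension *)

Section IdealTheory.
Variable A : comNzRingType.
Implicit Types (I J K M N P Q : set A) (x y a : A).

Lemma ideal0 I : ideal I -> I 0. Proof. by case. Qed.

Lemma idealM I a x : ideal I -> I x -> I (a * x).
Proof. by case=> I0 Il Ix; rewrite -[_ * _]addr0; exact: Il. Qed.

Lemma idealD I x y : ideal I -> I x -> I y -> I (x + y).
Proof. by case=> I0 Il Ix Iy; rewrite -[x]mul1r; exact: Il. Qed.

Lemma idealN I x : ideal I -> I x -> I (- x).
Proof. by move=> iI Ix; rewrite -mulN1r; exact: idealM. Qed.

Lemma idealB I x y : ideal I -> I x -> I y -> I (x - y).
Proof. by move=> iI Ix Iy; apply: idealD => //; exact: idealN. Qed.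

Lemma ideal_sum I (T : Type) (s : seq T) (p : pred T) (F : T -> A) :
  ideal I -> (forall i, p i -> I (F i)) -> I (\sum_(i <- s | p i) F i).
Proof.
move=> iI IF; apply: (big_ind I) => //; first exact: ideal0.
by move=> x y; exact: idealD.
Qed.

Lemma ideal_gen_ideal (X : set A) : ideal (ideal_gen X).
Proof.
split=> [|a x y hx hy] J [iJ XJ]; first by case: iJ.
by case: (iJ) => _; apply; [apply: hx|apply: hy].
Qed.

Lemma sub_ideal_gen (X : set A) : X `<=` ideal_gen X.
Proof. exact: sub_gen_smallest. Qed.

Lemma ideal_gen_sub (X : set A) I : ideal I -> X `<=` I -> ideal_gen X `<=` I.
Proof. by move=> iI XI; apply: smallest_sub. Qed.

Lemma ideal_setT : ideal [set: A]. Proof. by []. Qed.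

Lemma ideal_zero : ideal [set (0 : A)].
Proof. by split=> // a _ _ -> ->; rewrite /= mulr0 addr0. Qed.

Lemma ideal_colon I z : ideal I -> ideal [set x | I (x * z)].
Proof.
move=> iI; split=> [|a x y /= hx hy]; first by rewrite /= mul0r; exact: ideal0.
by rewrite mulrDl -mulrA; apply: idealD => //; exact: idealM.
Qed.

Lemma ideal_principal x : ideal (range ( *%R x)).
Proof.
split=> [|a _ _ [u _ <-] [v _ <-]]; first by exists 0; rewrite ?mulr0.
by exists (a * u + v) => //; ring.
Qed.

Lemma ideal_add I J : ideal I -> ideal J ->
  ideal [set x + y | x in I & y in J].
Proof.
move=> iI iJ; split.
  by exists 0; [exact: ideal0|exists 0; [exact: ideal0|rewrite addr0]].
move=> a _ _ [x Ix [y Jy <-]] [x' Ix' [y' Jy' <-]].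
exists (a * x + x'); first by case: iI => _; apply.
by exists (a * y + y'); [case: iJ => _; apply|ring].
Qed.

Lemma ideal_preimage (B : comNzRingType) (f : {rmorphism A -> B}) (J : set B) :
  ideal J -> ideal (f @^-1` J).
Proof.
move=> [J0 Jl]; split=> [|a x y hx hy]; first by rewrite /preimage /= rmorph0.
by rewrite /preimage /= rmorphD rmorphM; exact: Jl.
Qed.

Lemma prime_ideal_ideal P : prime_ideal P -> ideal P. Proof. by case. Qed.

Lemma primeM P x y : prime_ideal P -> P (x * y) -> P x \/ P y.
Proof. by case=> _ _; apply. Qed.

Lemma primeX P x n : prime_ideal P -> P (x ^+ n) -> P x.
Proof.
move=> pP; elim: n => [|n IH]; first by case: pP => _ + _ => /[apply].
by rewrite exprS => /(primeM pP)[].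
Qed.

Lemma prime_preimage (B : comNzRingType) (f : {rmorphism A -> B}) (P : set B) :
  prime_ideal P -> prime_ideal (f @^-1` P).
Proof.
move=> [iP P1 Pm]; split; first exact: ideal_preimage.
  by rewrite /preimage /= rmorph1.
by move=> x y; rewrite /preimage /= rmorphM; exact: Pm.
Qed.

Lemma exists_maximal_disjoint I (X : set A) :
  ideal I -> (forall x, I x -> ~ X x) ->
  exists P, [/\ ideal P, I `<=` P, forall x, P x -> ~ X x &
    forall J, ideal J -> P `<=` J -> (forall x, J x -> ~ X x) -> J = P].
Proof.
move=> iI IX.
(* The empty set is admitted so that the empty chain has an upper bound. *)
pose F := [set P : set A | P = set0 \/
  [/\ ideal P, I `<=` P & forall x, P x -> ~ X x]].
have [D DF Dtot|P [FP Pmax]] := @Zorn_bigcup A F.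
  have [[Y [DY [y Yy]]]|noY] := pselect (exists Y, D Y /\ exists y, Y y); last first.
    left; apply/seteqP; split=> // x [Y DY Yx]; case: noY.
    by exists Y; split=> //; exists x.
  have Dprop Z z : D Z -> Z z -> [/\ ideal Z, I `<=` Z & forall x, Z x -> ~ X x].
    by move=> DZ Zz; case: (DF Z DZ) => // Z0; move: Zz; rewrite Z0.
  right; have [iY IY YX] := Dprop Y y DY Yy; split.
  - split=> [|a u v [U DU Uu] [V DV Vv]].
      by exists Y => //; exact: ideal0.
    have [iU _ _] := Dprop U u DU Uu; have [iV _ _] := Dprop V v DV Vv.
    have [UV|VU] := Dtot U V DU DV.
      by exists V => //; case: iV => _; apply; [apply: UV|].
    by exists U => //; case: iU => _; apply; [|apply: VU].
  - by move=> x Ix; exists Y => //; exact: IY.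
  - by move=> x [Z DZ Zx]; have [_ _] := Dprop Z x DZ Zx; apply.
have FI : F I by apply: or_intror; split=> // x.
case: FP => [P0|[iP IP PX]].
  case: (Pmax I) => //; rewrite P0; split; first exact: sub0set.
  by move=> /(_ 0); apply; exact: ideal0.
exists P; split=> // J iJ PJ JX; apply: contrapT => JP.
apply: (Pmax J); last by apply: or_intror; split=> // x /IP /PJ.
by split=> // JP'; apply: JP; apply/seteqP.
Qed.

(** An ideal maximal among those missing a multiplicative set is prime. *)
Lemma exists_prime_disjoint I (X : set A) :
  ideal I -> X 1 -> (forall x y, X x -> X y -> X (x * y)) ->
  (forall x, I x -> ~ X x) ->
  exists P, [/\ prime_ideal P, I `<=` P & forall x, P x -> ~ X x].
Proof.
move=> iI X1 XM IX.
have [P [iP IP PX Pmax]] := exists_maximal_disjoint iI IX.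
exists P; split=> //; split=> // [P1|x y Pxy]; first exact: (PX 1).
have meets z : ~ P z -> exists p r, P p /\ X (p + z * r).
  move=> nPz; apply: contrapT => no; apply: nPz.
  have iJ := ideal_add iP (ideal_principal z).
  rewrite -(Pmax _ iJ).
  - exists 0; first exact: ideal0.
    by exists z; rewrite ?add0r //; exists 1; rewrite ?mulr1.
  - move=> p Pp; exists p => //; exists 0; rewrite ?addr0 //.
    by exists 0; rewrite ?mulr0.
  - by move=> _ [p Pp [_ [r _ <-] <-]] Xpr; apply: no; exists p, r.
apply: contrapT => /not_orP[/meets[p [r [Pp Xp]]] /meets[q [s [Pq Xq]]]].
apply: (PX _ _ (XM _ _ Xp Xq)).
have -> : (p + x * r) * (q + y * s)
  = (q + y * s) * p + ((x * r) * q + (r * s) * (x * y)) by ring.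
by do 2?[apply: idealD => //]; apply: idealM.
Qed.

Lemma exists_maximal_above I : ideal I -> ~ I 1 ->
  exists M, maximal_ideal M /\ I `<=` M.
Proof.
move=> iI I1; have [x Ix x1|M [iM IM MX Mmax]] :=
  @exists_maximal_disjoint I [set 1] iI.
  by apply: I1; rewrite -x1.
exists M; split=> //; split=> // [M1|J iJ MJ]; first exact: (MX 1).
have [J1|nJ1] := pselect (J 1).
  by right; apply/seteqP; split=> // x _; rewrite -[x]mulr1; exact: idealM.
by left; apply: Mmax => // x Jx x1; apply: nJ1; rewrite -x1.
Qed.

Lemma maximal_ideal_ideal M : maximal_ideal M -> ideal M. Proof. by case. Qed.

Lemma maximal_proper M : maximal_ideal M -> ~ M 1. Proof. by case. Qed.

Lemma maximal_eq M N : maximal_ideal M -> maximal_ideal N -> M `<=` N -> M = N.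
Proof.
by move=> [_ _ Mm] [iN N1 _] /(Mm N iN)[->|NT] //; case: N1; rewrite NT.
Qed.

Lemma maximal_inv M x : maximal_ideal M -> ~ M x -> exists r, M (1 - x * r).
Proof.
move=> mM nMx; have [iM M1 Mm] := mM.
have /Mm[] := ideal_add iM (ideal_principal x).
- move=> m Mm'; exists m => //; exists 0; rewrite ?addr0 //.
  by exists 0; rewrite ?mulr0.
- move=> JM; case: nMx; rewrite -JM; exists 0; first exact: ideal0.
  by exists x; rewrite ?add0r //; exists 1; rewrite ?mulr1.
- move=> JT; have [m Mm' [_ [r _ <-] e]] :
    [set u + v | u in M & v in range ( *%R x)] 1 by rewrite JT.
  by exists r; rewrite -e addrK.
Qed.

Lemma jacobson_unit x : (forall M, maximal_ideal M -> ~ M x) ->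
  exists y, x * y = 1.
Proof.
move=> nM; apply: contrapT => nu.
have [[y _ e]|M [mM sM]] := exists_maximal_above (ideal_principal x).
  by apply: nu; exists y.
by apply: (nM M mM); apply: sM; exists 1; rewrite ?mulr1.
Qed.

(** That x is a non-zerodivisor in the localization at P. *)
Definition regular_at P x : Prop :=
  forall c, x * c = 0 -> exists u, ~ P u /\ u * c = 0.

Lemma nzd_regular_at P x : prime_ideal P -> nzd A x -> regular_at P x.
Proof.
move=> [_ P1 _] nx c xc; exists 1; split=> //.
by rewrite mul1r; apply: nx; rewrite mulr0.
Qed.

(** The multiplicative set of all u x^n with u outside P misses 0 because x is
    regular at P, and a prime that avoids it lies in P and does not contain x.
    So a minimal prime has no element that is regular at it. *)
Lemma exists_smaller_prime P x : prime_ideal P -> P x -> regular_at P x ->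
  exists Q, [/\ prime_ideal Q, Q `<=` P & ~ Q x].
Proof.
move=> pP Px rx; have [iP P1 PM] := pP.
pose X := [set z | exists u n, ~ P u /\ z = u * x ^+ n].
have [||z z0 [u [n [nPu e]]]|Q [pQ _ QX]] := exists_prime_disjoint (X := X) ideal_zero.
- by exists 1, 0%N; rewrite mulr1.
- move=> _ _ [u [n [nu ->]]] [v [m [nv ->]]]; exists (u * v), (n + m)%N.
  by rewrite exprD; split; [move/PM => []|ring].
- move: e; rewrite z0; elim: n u nPu => [|n IH] u nPu.
    by rewrite mulr1 => u0; apply: nPu; rewrite -u0; exact: ideal0.
  rewrite exprSr mulrA [_ * x]mulrC => /esym/rx[v [nPv]].
  by rewrite mulrA => /esym/IH; apply; move/PM => [].
- exists Q; split=> // [z Qz|Qx].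
    by apply: contrapT => nPz; apply: (QX z Qz); exists z, 0%N; rewrite mulr1.
  by apply: (QX x Qx); exists 1, 1%N; rewrite mul1r.
Qed.

(** Krull dimension at most one: every longer chain of primes starts with three
    primes. *)
Definition dim_le1 : Prop := forall P0 P1 P2,
  prime_ideal P0 -> prime_ideal P1 -> prime_ideal P2 ->
  P0 `<` P1 -> P1 `<` P2 -> False.

(** A regular element leaves room for a prime below P, so there is none above. *)
Lemma dim_le1_maximal P x : dim_le1 -> prime_ideal P -> P x ->
  regular_at P x -> maximal_ideal P.
Proof.
move=> d1 pP Px rx; have [iP P1 _] := pP.
have [Q [pQ QP nQx]] := exists_smaller_prime pP Px rx.
have [M [mM PM]] := exists_maximal_above iP P1.
have [MP|nMP] := pselect (M `<=` P).
  by have -> : P = M by apply/seteqP.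
exfalso; apply: (d1 Q P M) => //; first exact: maximal_prime.
by split=> // /(_ x Px).
Qed.

(** In dimension one the primes over a non-zerodivisor are maximal, so its
    radical contains the Jacobson radical. *)
Lemma jacobson_power x y : dim_le1 -> nzd A x ->
  (forall M, maximal_ideal M -> M y) -> exists n r, y ^+ n = x * r.
Proof.
move=> d1 nx Jy; apply: contrapT => no.
have [|_ _ [m _ <-] [n _ <-]|z [r _ <-] [n _ yn]|P [pP xP PX]] :=
  @exists_prime_disjoint _ (range (fun n => y ^+ n)) (ideal_principal x).
- by exists 0%N.
- by exists (m + n)%N; rewrite ?exprD.
- by apply: no; exists n, r.
- have Px : P x by apply: xP; exists 1; rewrite ?mulr1.
  have mP := dim_le1_maximal d1 pP Px (nzd_regular_at pP nx).
  by apply: (PX y); [exact: Jy|exists 1%N].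
Qed.

End IdealTheory.

Section FiniteGeneration.
Variable A : comNzRingType.

Lemma ideal_gen_mono (X Y : set A) : X `<=` Y -> ideal_gen X `<=` ideal_gen Y.
Proof.
move=> XY; apply: ideal_gen_sub; first exact: ideal_gen_ideal.
by move=> x /XY; exact: sub_ideal_gen.
Qed.

Lemma ideal_gen_finite (X : set A) x : ideal_gen X x ->
  exists s : seq A, [set` s] `<=` X /\ ideal_gen [set` s] x.
Proof.
apply: (@ideal_gen_sub _ _ [set x | exists s : seq A,
  [set` s] `<=` X /\ ideal_gen [set` s] x]) => [|y Xy]; last first.
  exists [:: y]; split; first by move=> z /=; rewrite inE => /eqP->.
  by apply: sub_ideal_gen; rewrite /= mem_head.
split; first by exists [::]; split=> //; exact: ideal0 (ideal_gen_ideal _).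
move=> a y z [s [sX sy]] [t [tX tz]]; exists (s ++ t); split.
  by move=> u /=; rewrite mem_cat => /orP[/sX|/tX].
have iG := @ideal_gen_ideal A [set` s ++ t].
by case: (iG) => _; apply; [apply: ideal_gen_mono sy|apply: ideal_gen_mono tz];
  move=> u /=; rewrite mem_cat => ->; rewrite ?orbT.
Qed.

(** A finite generating set need not consist of elements of X, but each of its
    members is a combination of finitely many of them. *)
Lemma noetherian_generators (X : set A) : noetherian A ->
  exists s : seq A, [set` s] `<=` X /\ ideal_gen X `<=` ideal_gen [set` s].
Proof.
move=> nA; have [t et] := nA _ (@ideal_gen_ideal A X).
suff [s [sX ts]] : exists s : seq A, [set` s] `<=` X /\
    [set` t] `<=` ideal_gen [set` s].
  by exists s; split=> //; rewrite et; apply: ideal_gen_sub => //; exact: ideal_gen_ideal.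
have : [set` t] `<=` ideal_gen X by rewrite et; exact: sub_ideal_gen.
elim: t {et} => [|x t IH] tX; first by exists [::].
have [|s [sX ts]] := IH; first by move=> y yt; apply: tX; rewrite /= inE orbC [_ \in _]yt.
have [|r [rX rx]] := @ideal_gen_finite X x; first by apply: tX; rewrite /= mem_head.
exists (r ++ s); split; first by move=> u /=; rewrite mem_cat => /orP[/rX|/sX].
move=> u /=; rewrite inE => /orP[/eqP->|/ts].
  by apply: ideal_gen_mono rx => v /=; rewrite mem_cat => ->.
by apply: ideal_gen_mono => v /=; rewrite mem_cat => ->; rewrite orbT.
Qed.

End FiniteGeneration.

(** * Localization *)

Section LocalizationTheory.
Variables (A : comNzRingType) (S : mulset A).
Local Notation tof := (@tofrac A S).

Lemma frac_tofrac x s (Ss : S s) : frac x Ss = frac 1 Ss * tof x.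
Proof.
rewrite -[RHS]/(Localization.mul _ _) /tofrac Localization.mul_frac.
by apply: Localization.frac_eq1; ring.
Qed.

Lemma tofrac_frac x s (Ss : S s) : tof x = tof s * frac x Ss.
Proof.
rewrite -[RHS]/(Localization.mul _ _) /tofrac Localization.mul_frac.
by apply: Localization.frac_eq1; ring.
Qed.

Lemma tofrac_eq x y : tof x = tof y <-> exists u, S u /\ u * x = u * y.
Proof.
rewrite /tofrac; split=> [/Localization.frac_eq[u [Su]]|[u [Su e]]].
  by rewrite !mulr1 => e; exists u.
by apply/Localization.frac_eq; exists u; rewrite !mulr1.
Qed.

Lemma frac_in (J : set (localization S)) x s (Ss : S s) :
  ideal J -> J (frac x Ss) <-> J (tof x).
Proof.
by move=> iJ; split=> h; [rewrite (tofrac_frac _ Ss)|rewrite frac_tofrac];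
  exact: idealM.
Qed.

Lemma noetherian_localization :
  noetherian A -> noetherian (localization S : comNzRingType).
Proof.
move=> nA J iJ; have [s es] := nA _ (ideal_preimage tof iJ).
exists [seq tof x | x <- s]; apply/seteqP; split; last first.
  apply: ideal_gen_sub => // _ /mapP[x xs ->].
  by have : ideal_gen [set` s] x by [exact: sub_ideal_gen]; rewrite -es.
move=> z; have [x [t [St ->]]] := Localization.fracP z.
have iG := @ideal_gen_ideal _ [set` [seq tof x | x <- s]].
move=> /frac_in => /(_ iJ) Jx; apply/frac_in => //.
have : ideal_gen [set` s] x by rewrite -es.
apply: (ideal_gen_sub (ideal_preimage tof iG)) => y ys.
by apply: sub_ideal_gen; apply/mapP; exists y.
Qed.

Lemma localization_sub (J K : set (localization S)) : ideal J -> ideal K ->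
  tof @^-1` J `<=` tof @^-1` K -> J `<=` K.
Proof.
move=> iJ iK JK z; have [x [t [St ->]]] := Localization.fracP z.
by move=> /frac_in => /(_ iJ) Jx; apply/frac_in => //; exact: JK.
Qed.

Lemma localization_contract_disjoint (P : set (localization S)) x :
  prime_ideal P -> S x -> ~ P (tof x).
Proof.
move=> [iP P1 _] Sx Px; apply: P1.
have -> : 1 = frac 1 Sx * tof x.
  by rewrite -frac_tofrac; apply: Localization.frac_eq1; ring.
exact: idealM.
Qed.

Lemma tofrac_regular x : nzd A x -> nzd (localization S : comNzRingType) (tof x).
Proof.
move=> nx z w; have [a [s [Ss ->]]] := Localization.fracP z.
have [b [t [St ->]]] := Localization.fracP w.
rewrite -![tof x * _]/(Localization.mul _ _) /tofrac !Localization.mul_frac.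
move=> /Localization.frac_eq[u [Su]]; rewrite !mul1r => e.
apply/Localization.frac_eq; exists u; split=> //; apply: nx.
have -> : x * (u * (a * t)) = u * (x * a * t) by ring.
by rewrite e; ring.
Qed.

(** For a prime P disjoint from S this is the prime of the localization that
    corresponds to P. *)
Definition loc_ext (P : set A) : set (localization S) :=
  [set z | exists x s (Ss : S s), P x /\ z = frac x Ss].

Section ExtendPrime.
Variable P : set A.
Hypotheses (pP : prime_ideal P) (PS : forall x, P x -> ~ S x).

Lemma loc_ext_frac x s (Ss : S s) : loc_ext P (frac x Ss) <-> P x.
Proof.
split=> [[y [t [St [Py /Localization.frac_eq[u [Su e]]]]]]|Px]; last first.
  by exists x, s, Ss.
have : P (u * (x * t)).
  by rewrite e mulrA; rewrite mulrC mulrA; apply: idealM => //; case: pP.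
by move=> /(primeM pP)[/PS|/(primeM pP)[|/PS]].
Qed.

Lemma loc_ext_prime : prime_ideal (loc_ext P).
Proof.
have [iP P1 PM] := pP; split; first split.
- by apply/loc_ext_frac; exact: ideal0.
- move=> a z w; have [x [s [Ss ->]]] := Localization.fracP a.
  have [y [t [St ->]]] := Localization.fracP z.
  have [v [r [Sr ->]]] := Localization.fracP w.
  move=> /loc_ext_frac Py /loc_ext_frac Pv.
  rewrite -[_ + _]/(Localization.add (Localization.mul _ _) _).
  rewrite Localization.mul_frac Localization.add_frac; apply/loc_ext_frac.
  apply: idealD => //; last by rewrite mulrC; exact: idealM.
  by rewrite mulrC mulrA; exact: idealM.
- by move/loc_ext_frac.
- move=> z w; have [x [s [Ss ->]]] := Localization.fracP z.
  have [y [t [St ->]]] := Localization.fracP w.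
  rewrite -[_ * _]/(Localization.mul _ _) Localization.mul_frac.
  by move=> /loc_ext_frac/PM[?|?]; [left|right]; apply/loc_ext_frac.
Qed.

Lemma loc_ext_contract : tof @^-1` loc_ext P = P.
Proof.
by apply/seteqP; split=> x; [move/loc_ext_frac|move=> Px; apply/loc_ext_frac].
Qed.

End ExtendPrime.

Lemma dim_le1_localization :
  dim_le1 A -> dim_le1 (localization S : comNzRingType).
Proof.
move=> d1 P0 P1 P2 p0 p1 p2 l01 l12.
have lt P Q : prime_ideal P -> prime_ideal Q -> P `<` Q ->
    tof @^-1` P `<` tof @^-1` Q.
  move=> pP pQ [PQ nQP]; split=> [z|QP]; first exact: PQ.
  by apply: nQP; apply: localization_sub => //; exact: prime_ideal_ideal.
by apply: (d1 (tof @^-1` P0) (tof @^-1` P1) (tof @^-1` P2));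
  (exact: prime_preimage || exact: lt).
Qed.

End LocalizationTheory.

Section LocalizationAtMaximal.
Variables (A : comNzRingType) (M : set A) (mM : maximal_ideal M).
Local Notation pM := (maximal_prime mM).
Local Notation S := (compl_prime pM).

Lemma prime_sub_disjoint (P : set A) : P `<=` M <-> forall x, P x -> ~ S x.
Proof.
split=> [PM x /PM Mx nMx|PS x /PS nnMx]; first exact: nMx.
exact: contrapT.
Qed.

Lemma localization_at_local (N : set (localization_at pM)) :
  maximal_ideal N <-> N = loc_ext M.
Proof.
have sM : forall x, M x -> ~ S x by exact: (prime_sub_disjoint M).1.
have pE := loc_ext_prime pM sM.
have max_eq N' : maximal_ideal N' -> N' = loc_ext M :> set (localization_at pM).
  move=> mN; have [iN N1 Nm] := mN; have [iE E1 _] := pE.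
  case: (Nm _ iE).
  - apply: localization_sub => //; rewrite (loc_ext_contract pM sM).
    apply/prime_sub_disjoint => x Nx Sx.
    by apply: (localization_contract_disjoint (maximal_prime mN) Sx).
  - by move->.
  - by move=> ET; case: E1; rewrite ET.
split=> [/max_eq//|->].
have [iE E1 _] := pE; have [N' [mN _]] := exists_maximal_above iE E1.
by rewrite -(max_eq _ mN).
Qed.

End LocalizationAtMaximal.

(** * Chains of primes and depth *)

Lemma dim_le1P (A : comNzRingType) :
  dim_le1 A <-> forall m P, @prime_chain A m P -> (m <= 1)%N.
Proof.
split=> [d1 m P [pP cP]|dm P0 P1 P2 p0 p1 p2 l01 l12].
  rewrite leqNgt; apply/negP => m2.
  have lt i : (i <= 2)%N -> (i < m.+1)%N by move=> i2; exact: leq_trans m2.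
  apply: (d1 (P (Ordinal (lt 0%N isT))) (P (Ordinal (lt 1%N isT)))
            (P (Ordinal (lt 2%N isT)))) => //; exact: cP.
pose s := [:: P0; P1; P2].
suff : @prime_chain A 2 (fun i => nth P0 s i) by move/dm.
split; first by case=> -[|[|[|]]].
case=> -[|[|[|]]] // ? [[|[|[|]]]] //= _ _.
have [[s01 _] [s12 n21]] := (l01, l12).
by split=> [z /s01/s12//|s20]; apply: n21 => z /s20/s01.
Qed.

Lemma has_krull_dim_unique (A : comNzRingType) m n :
  has_krull_dim A m -> has_krull_dim A n -> m = n.
Proof.
move=> [[P cP] um] [[Q cQ] un]; apply/eqP; rewrite eqn_leq.
by rewrite (un _ _ cP) (um _ _ cQ).
Qed.

Lemma ideal_gen_nil (A : comNzRingType) (x : A) :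
  ideal_gen [set` [::]] x <-> x = 0.
Proof.
split=> [|->]; last exact: ideal0 (ideal_gen_ideal _).
by apply: (ideal_gen_sub (@ideal_zero A)).
Qed.

Section LocalDepth.
Variables (A : comNzRingType) (M : set A).
Hypotheses (nA : noetherian A) (lA : forall N, maximal_ideal N <-> N = M).
Hypotheses (d1 : dim_le1 A).

Let mM : maximal_ideal M. Proof. by apply/lA. Qed.

(** If x, y is a regular sequence, some power of y is a multiple of x by the
    dimension; cancelling y modulo x puts 1 into the ideal (x). *)
Lemma regular_sequence_size s :
  regular_sequence s -> [set` s] `<=` M -> (size s <= 1)%N.
Proof.
case: s => [|x [|y s]] // [_ rs] sM; exfalso.
have Mx : M x by apply: sM; rewrite /= mem_head.
have My : M y by apply: sM; rewrite /= !inE eqxx orbT.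
have nx : nzd A x.
  move=> c d xcd; apply/eqP; rewrite -subr_eq0; apply/eqP.
  apply/ideal_gen_nil; apply: (rs 0%N isT (c - d)).
  by rewrite /= mulrBr xcd subrr; apply/ideal_gen_nil.
have [|n [r yn]] := jacobson_power (y := y) d1 nx; first by move=> N /lA->.
have {r}yn : ideal_gen [set` [:: x]] (y ^+ n).
  rewrite yn mulrC; apply: (idealM r (@ideal_gen_ideal A _)).
  by apply: sub_ideal_gen; rewrite /= mem_head.
have G1 : ideal_gen [set` [:: x]] 1.
  elim: n yn => [//|n IH]; rewrite exprS => yn; apply: IH.
  exact: (rs 1%N).
apply: (maximal_proper mM); apply: ideal_gen_sub G1; first by case: mM.
by move=> z /=; rewrite inE => /eqP->.
Qed.

Lemma local_cohen_macaulay y : M y -> nzd A y ->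
  has_krull_dim A 1 /\ cohen_macaulay_local A.
Proof.
move=> My ny; have ry := nzd_regular_at (maximal_prime mM) ny.
have dA : has_krull_dim A 1.
  split; last exact/dim_le1P.
  have [Q [pQ QM nQy]] := exists_smaller_prime (maximal_prime mM) My ry.
  exists (fun i => nth Q [:: Q; M] i); split.
    by case=> -[|[|]] //= _; exact: maximal_prime.
  by case=> -[|[|]] // ? [[|[|]]] //= _ _; split=> // /(_ y My).
split=> //; split=> //; exists M; split=> //; exists 1%N; split=> //.
split; last exact: regular_sequence_size.
exists [:: y]; split=> //; last by move=> z /=; rewrite inE => /eqP->.
split.
  move=> G1; apply: (maximal_proper mM); apply: ideal_gen_sub G1.
    exact: maximal_ideal_ideal.
  by move=> z /=; rewrite inE => /eqP->.
case=> // _ z /= /ideal_gen_nil yz; apply/ideal_gen_nil.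
by apply: ny; rewrite yz mulr0.
Qed.

End LocalDepth.

(** * Semi-local rings with one-dimensional Cohen-Macaulay localizations *)

Section OneDimCM.
Variable A : comNzRingType.
Implicit Types M N P : set A.

Lemma nzd_of_regular_at x :
  (forall M, maximal_ideal M -> regular_at M x) -> nzd A x.
Proof.
move=> rx c d xcd; apply/eqP; rewrite -subr_eq0; apply/eqP.
have xc0 : x * (c - d) = 0 by rewrite mulrBr xcd subrr.
have iann : ideal [set u | u * (c - d) = 0].
  split=> [|a u v /= hu hv]; first by rewrite /= mul0r.
  by rewrite mulrDl -mulrA hu hv mulr0 addr0.
apply: contrapT => ncd.
have [|M [mM aM]] := exists_maximal_above iann; first by rewrite /= mul1r.
by have [u [nMu uc]] := rx M mM _ xc0; apply: nMu; exact: aM.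
Qed.

(** The only prime inside M that contains a is M, so in the localization at M the
    radical of (a) is the maximal ideal. *)
Lemma regular_at_power M a e : dim_le1 A -> maximal_ideal M -> M a ->
  regular_at M a -> M e -> exists u n r, ~ M u /\ u * e ^+ n = a * r.
Proof.
move=> d1 mM Ma ra Me; apply: contrapT => no; have [iM M1 _] := mM.
pose X := [set z | exists u n, ~ M u /\ z = u * e ^+ n].
have [|||P [pP aP PX]] := @exists_prime_disjoint A _ X (ideal_principal a).
- by exists 1, 0%N; rewrite mulr1.
- move=> _ _ [u [n [nu ->]]] [v [m [nv ->]]]; exists (u * v), (n + m)%N.
  by rewrite exprD; split; [move/(primeM (maximal_prime mM)) => []|ring].
- by move=> z [r _ <-] [u [n [nu e']]]; apply: no; exists u, n, r.
have PM : P `<=` M.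
  by move=> z Pz; apply: contrapT => nMz; apply: (PX z Pz); exists z, 0%N; rewrite mulr1.
have mP : maximal_ideal P.
  apply: (@dim_le1_maximal _ _ a) => //; first by apply: aP; exists 1; rewrite ?mulr1.
  by move=> c /ra[u [nMu uc]]; exists u; split=> // /PM.
apply: (PX e); first by rewrite (maximal_eq mP mM PM).
by exists 1, 1%N; rewrite mul1r.
Qed.

(** Elements a_M regular at single maximal ideals M are glued into one element
    sum_M e_M a_M, where e_M avoids M but is so deep inside the other maximal
    ideals N that it lies in a_N N locally; at each M the sum is then a_M times
    a unit. *)
Lemma exists_jacobson_nzd : semilocal A -> dim_le1 A ->
  (forall M, maximal_ideal M -> exists a, M a /\ regular_at M a) ->
  exists y, nzd A y /\ forall M, maximal_ideal M -> M y.
Proof.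
move=> sA d1 ex_a.
have [M|a aP] := @choice _ _ (fun M z => maximal_ideal M -> M z /\ regular_at M z).
  by have [/ex_a[z]|] := pselect (maximal_ideal M); [exists z|exists 0].
(* Locally at N, the element z is in a_N N. *)
pose deep N z := exists u m, [/\ ~ N u, N m & u * z = a N * m].
(* A high power of an element of N outside M. *)
have ex_c (MN : set A * set A) : exists c,
    maximal_ideal MN.1 -> maximal_ideal MN.2 -> MN.1 != MN.2 ->
    [/\ ~ MN.1 c, MN.2 c & deep MN.2 c].
  case: MN => M N /=.
  have [mM|] := pselect (maximal_ideal M); last by exists 0.
  have [mN|] := pselect (maximal_ideal N); last by exists 0.
  have [->|/eqP MN] := eqVneq M N; first by exists 0.
  have [e [Ne nMe]] : exists e, N e /\ ~ M e.
    apply: contrapT => no; apply: MN; apply/esym; apply: maximal_eq => // z Nz.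
    by apply: contrapT => nMz; apply: no; exists z.
  have [Na ra] := aP N mN; have iN := maximal_ideal_ideal mN.
  have [u [n [r [nNu ue]]]] := regular_at_power d1 mN Na ra Ne.
  exists (e ^+ n.+1) => _ _ _; split.
  - by move/(primeX (maximal_prime mM)).
  - by rewrite exprSr; exact: idealM.
  - exists u, (r * e); split=> //; first exact: idealM.
    by rewrite exprSr mulrA ue mulrA.
have [c cP] := choice ex_c.
have /finite_seqP[s es] := sA.
have sP M : M \in undup s <-> maximal_ideal M.
  have -> : maximal_ideal M = [set M | maximal_ideal M] M by [].
  by rewrite es mem_undup.
pose e M := \prod_(N <- undup s | N != M) c (M, N).
have e_deep M N : maximal_ideal M -> maximal_ideal N -> M != N ->
    N (e M) /\ deep N (e M).
  move=> mM mN MN; have [_ Nc [u [m [nNu Nm uc]]]] := cP (M, N) mM mN MN.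
  have iN := maximal_ideal_ideal mN.
  have NM : N != M by rewrite eq_sym.
  have Ns : N \in undup s by apply/sP.
  rewrite /e big_mkcond (bigD1_seq N) ?undup_uniq //= NM.
  split; first by rewrite mulrC; exact: idealM.
  set p := \prod_(_ <- _ | _) _; exists u, (p * m); split=> //; first exact: idealM.
  have -> : u * (c (M, N) * p) = p * (u * c (M, N)) by ring.
  by rewrite uc; ring.
have e_out M : maximal_ideal M -> ~ M (e M).
  move=> mM; rewrite /e big_seq_cond.
  apply: (@big_ind A (fun z => ~ M z)); first by case: mM.
    by move=> z w nz nw /(primeM (maximal_prime mM))[].
  by move=> N /andP[/sP mN NM]; have [] := cP (M, N) mM mN; rewrite // eq_sym.
pose x := \sum_(M <- undup s) e M * a M.
have xE M : maximal_ideal M ->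
    x = e M * a M + \sum_(N <- undup s | N != M) e N * a N.
  by move=> mM; rewrite /x (bigD1_seq M) ?undup_uniq //=; apply/sP.
exists x; split; last first.
  move=> M mM; have iM := maximal_ideal_ideal mM; have [Ma _] := aP M mM.
  rewrite (xE M mM); apply: idealD => //; first exact: idealM.
  rewrite big_seq_cond; apply: ideal_sum => // N /andP[/sP mN NM].
  by rewrite mulrC; apply: idealM => //; have [] := e_deep N M mN mM NM.
apply: nzd_of_regular_at => M mM d.
have iM := maximal_ideal_ideal mM; have pM := maximal_prime mM.
have [Ma ra] := aP M mM.
have ideep : ideal (deep M).
  split; first by exists 1, 0; rewrite !mulr0; split; [case: mM|exact: ideal0|].
  move=> t z w [u [m [nu Mm uz]]] [v [m' [nv Mm' vw]]].
  exists (u * v), (t * v * m + u * m'); split.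
  - by case/(primeM pM).
  - by apply: idealD => //; exact: idealM.
  - have -> : u * v * (t * z + w) = t * v * (u * z) + u * (v * w) by ring.
    by rewrite uz vw; ring.
have [u [m [nu Mm ur]]] : deep M (\sum_(N <- undup s | N != M) e N * a N).
  rewrite big_seq_cond; apply: ideal_sum => // N /andP[/sP mN NM].
  by rewrite mulrC; apply: idealM => //; have [] := e_deep N M mN mM NM.
rewrite (xE M mM) => xd.
have /ra[v [nv vd]] : a M * ((u * e M + m) * d) = 0.
  have -> : a M * ((u * e M + m) * d) = (u * (e M * a M) + a M * m) * d by ring.
  by rewrite -ur -mulrDr -mulrA xd mulr0.
exists (v * (u * e M + m)); split; last by rewrite -mulrA.
case/(primeM pM) => // Muem; have : M (u * e M).
  by rewrite -[u * e M](addrK m); exact: idealB.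
by case/(primeM pM) => // /(e_out M mM).
Qed.

Lemma one_dim_cm_dim_le1 : one_dim_cm_semilocal A -> dim_le1 A.
Proof.
move=> [_ _ h] P0 P1 P2 p0 p1 p2 [s01 n01] [s12 n12].
have [iP2 P21 _] := p2; have [M [mM PM]] := exists_maximal_above iP2 P21.
have [[_ /dim_le1P d1] _] := h M mM.
have dis P : P `<=` P2 -> forall x, P x -> ~ compl_prime (maximal_prime mM) x.
  by move=> PP2; apply: (prime_sub_disjoint mM P).1 => x /PP2/PM.
have mono P Q : prime_ideal P -> prime_ideal Q -> P `<=` P2 -> Q `<=` P2 ->
    P `<=` Q -> ~ Q `<=` P ->
    @loc_ext _ (compl_prime (maximal_prime mM)) P `<` loc_ext Q.
  move=> pP pQ PP2 QP2 PQ nQP; split.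
    by move=> z [x [t [St [Px ->]]]]; exists x, t, St; split=> //; exact: PQ.
  move=> QP; apply: nQP.
  rewrite -(loc_ext_contract pP (dis P PP2)) -(loc_ext_contract pQ (dis Q QP2)).
  by move=> z; exact: QP.
have s02 : P0 `<=` P2 by move=> z /s01/s12.
apply: (d1 (loc_ext P0) (loc_ext P1) (loc_ext P2)).
- by apply: loc_ext_prime => //; exact: dis.
- by apply: loc_ext_prime => //; exact: dis.
- by apply: loc_ext_prime => //; exact: dis.
- exact: mono.
- exact: mono.
Qed.

Lemma one_dim_cm_regular_at M : one_dim_cm_semilocal A -> maximal_ideal M ->
  exists a, M a /\ regular_at M a.
Proof.
move=> [_ _ h] mM; have [dA [_ [N [lN [n [dn [[s [rs sN zs]] _]]]]]]] := h M mM.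
move: zs; rewrite (has_krull_dim_unique dn dA) {n dn dA}.
case: s rs sN => [|t [|]] // [_ rs] sN _.
have NE : N = @loc_ext _ (compl_prime (maximal_prime mM)) M.
  by apply: (localization_at_local N).1; apply/lN.
have Nt : N t by apply: sN; rewrite /= mem_head.
have tdis := (prime_sub_disjoint mM M).1 (fun x h => h).
move: rs Nt; rewrite {}NE {sN}; have [a [v [Sv ->]]] := Localization.fracP t.
move=> rs /(loc_ext_frac (maximal_prime mM) tdis) Ma.
exists a; split=> // c ac.
have /(tofrac_eq _ c 0)[u [Su]] : tofrac _ c = 0 :> localization (compl_prime (maximal_prime mM)).
  apply/ideal_gen_nil; apply: (rs 0%N) => //=; apply/ideal_gen_nil.
  by rewrite frac_tofrac -mulrA -rmorphM ac rmorph0 mulr0.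
by rewrite mulr0; exists u.
Qed.

(** The condition on localizations is traded for global ones that pass to the
    invariant subring: dimensions are compared by lying over, and the norm of a
    non-zerodivisor in the Jacobson radical has the same properties. *)
Theorem one_dim_cm_semilocalP : one_dim_cm_semilocal A <->
  [/\ noetherian A, semilocal A, dim_le1 A &
      exists y, nzd A y /\ forall M, maximal_ideal M -> M y].
Proof.
split=> [h|[nA sA d1 [y [ny Jy]]]].
  have d1 := one_dim_cm_dim_le1 h; have [nA sA _] := h; split=> //.
  by apply: exists_jacobson_nzd => // M; exact: one_dim_cm_regular_at.
split=> // M mM.
apply: (local_cohen_macaulay (noetherian_localization nA)
  (@localization_at_local _ _ mM) (dim_le1_localization d1) (y := tofrac _ y)).
  by apply/loc_ext_frac; [exact: maximal_prime|exact: (prime_sub_disjoint mM M).1|exact: Jy].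
exact: tofrac_regular.
Qed.

End OneDimCM.

(** * The invariant subring *)

Section InvariantVal.
Variables (R : comNzRingType) (G : set (ring_aut R)).

Fact invariant_val_zmod : zmod_morphism (@invariant_val R G).
Proof. by []. Qed.

Fact invariant_val_monoid : monoid_morphism (@invariant_val R G).
Proof. by []. Qed.

HB.instance Definition _ :=
  GRing.isZmodMorphism.Build _ _ (@invariant_val R G) invariant_val_zmod.
HB.instance Definition _ :=
  GRing.isMonoidMorphism.Build _ _ (@invariant_val R G) invariant_val_monoid.

End InvariantVal.

Section Invariants.
Variables (R : comNzRingType) (G : set (ring_aut R)).
Hypothesis hG : finite_subgroup G.
Variable b : R.
Hypothesis hb : b * (group_order G)%:R = 1.
Local Notation S := (invariant_ring G).
Local Notation valS := (@invariant_val R G).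
Implicit Types (g h : ring_aut R) (x y : R) (s t : S).

Let sG : seq (ring_aut R) := enum_fset (fset_set G).

Lemma mem_sG g : g \in sG <-> G g.
Proof.
have [_ fG] := hG.
by rewrite /sG -[_ \in _]/(g \in fset_set G) in_fset_set // inE.
Qed.

Lemma mem_group1 : G 1%g.
Proof. by have [[+ _] _] := hG; move/set_mem. Qed.

Lemma mem_groupM g h : G g -> G h -> G (g * h)%g.
Proof.
move=> Gg Gh; have [gG _] := hG.
by apply: set_mem; apply: (group_closedM gG); apply: mem_set.
Qed.

Lemma mem_groupV g : G g -> G (g^-1)%g.
Proof.
move=> Gg; have [gG _] := hG.
by apply: set_mem; apply: (group_closedV gG); apply: mem_set.
Qed.

Lemma perm_groupM h : G h -> perm_eq [seq (h * g)%g | g <- sG] sG.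
Proof.
move=> Gh; apply: uniq_perm.
- by rewrite map_inj_uniq ?fset_uniq //; exact: mulgI.
- exact: fset_uniq.
- move=> g; apply/idP/idP => [/mapP[k /mem_sG Gk ->]|/mem_sG Gg].
    by apply/mem_sG; exact: mem_groupM.
  apply/mapP; exists (h^-1 * g)%g; last by rewrite mulVKg.
  by apply/mem_sG; apply: mem_groupM => //; exact: mem_groupV.
Qed.

Lemma invariantE g s : G g -> g (valS s) = valS s.
Proof. by case: s => x /= /asboolP; apply. Qed.

Lemma group_invE g x : G g -> exists2 y, y = (g^-1)%g x & g y = x.
Proof. by exists ((g^-1)%g x) => //; exact: aut_inv_funK. Qed.

Lemma avg_scalar_fixed g : g b = b.
Proof.
have e : g b * (group_order G)%:R = 1.
  by rewrite -(rmorph_nat g) -rmorphM hb rmorph1.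
by rewrite -[LHS]mulr1 -hb mulrCA e mulr1.
Qed.

Lemma reynolds_subproof x : b * \sum_(g <- sG) g x \in invariant G.
Proof.
apply/asboolP => h Gh; rewrite rmorphM /= avg_scalar_fixed rmorph_sum /=.
by congr (_ * _); rewrite -[RHS](perm_big _ (perm_groupM Gh)) big_map.
Qed.

(** The average over G, an S-linear retraction of R onto S. *)
Definition reynolds x : S := InvariantRing (reynolds_subproof x).

Lemma norm_subproof x : \prod_(g <- sG) g x \in invariant G.
Proof.
apply/asboolP => h Gh; rewrite rmorph_prod /=.
by rewrite -[RHS](perm_big _ (perm_groupM Gh)) big_map.
Qed.

Definition norm x : S := InvariantRing (norm_subproof x).

Lemma reynoldsD x y : reynolds (x + y) = reynolds x + reynolds y.
Proof.
apply: val_inj; rewrite /= -mulrDr -big_split /=.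
by congr (_ * _); apply: eq_bigr => g _; rewrite rmorphD.
Qed.

Lemma reynoldsM s x : reynolds (valS s * x) = s * reynolds x.
Proof.
apply: val_inj; rewrite /= [RHS]mulrCA; congr (_ * _); rewrite mulr_sumr.
by apply: eq_big_seq => g /mem_sG Gg; rewrite rmorphM /= invariantE.
Qed.

Lemma reynolds_val s : reynolds (valS s) = s.
Proof.
suff e : reynolds 1 = 1 by rewrite -[valS s]mulr1 reynoldsM e mulr1.
apply: val_inj => /=.
under eq_bigr do rewrite rmorph1.
by rewrite big_const_seq count_predT iter_addr_0.
Qed.

Lemma reynolds0 : reynolds 0 = 0.
Proof. by rewrite -[X in reynolds X](rmorph0 valS) reynolds_val. Qed.

Lemma reynolds_sum (T : Type) (r : seq T) (p : pred T) (F : T -> R) :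
  reynolds (\sum_(i <- r | p i) F i) = \sum_(i <- r | p i) reynolds (F i).
Proof. exact: (big_morph reynolds reynoldsD reynolds0). Qed.

Lemma reynolds_ideal (K : set R) x :
  ideal K -> (forall g, G g -> K (g x)) -> K (valS (reynolds x)).
Proof.
move=> iK Kx; apply: (idealM b iK); rewrite big_seq_cond; apply: ideal_sum => // g.
by rewrite andbT => /mem_sG; exact: Kx.
Qed.

Lemma reynolds_congr (K : set R) x s :
  ideal K -> (forall g, G g -> K (g x - valS s)) ->
  K (valS (reynolds x) - valS s).
Proof.
move=> iK Kx; rewrite -rmorphB -[s in reynolds x - s]reynolds_val.
have -> : reynolds x - reynolds (valS s) = reynolds (x - valS s).
  by rewrite reynoldsD -(rmorphN valS) !reynolds_val.
apply: reynolds_ideal => // g Gg; rewrite rmorphB /= invariantE //; exact: Kx.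
Qed.

Lemma norm_ideal I x : ideal I -> I x -> I (valS (norm x)).
Proof.
move=> iI Ix /=; rewrite (bigD1_seq 1%g) ?fset_uniq //=.
  by rewrite mulrC; exact: idealM.
by apply/mem_sG; exact: mem_group1.
Qed.

Lemma aut_nzd g x : nzd R x -> nzd R (g x).
Proof.
move=> nx y z; rewrite -[y](aut_inv_funK g) -[z](aut_inv_funK g) -!rmorphM.
by move/(bij_inj (aut_bij g))/nx => ->.
Qed.

Lemma norm_nzd x : nzd R x -> nzd R (valS (norm x)).
Proof.
move=> nx /=; apply: (big_ind (nzd R)); first exact: lreg1.
  by move=> ? ?; exact: lregM.
by move=> g _; exact: aut_nzd.
Qed.

Lemma val_nzd s : nzd R (valS s) -> nzd S s.
Proof.
by move=> ns t u /(congr1 valS); rewrite !rmorphM => /ns/val_inj.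
Qed.

(** The extension IR. *)
Definition ext (I : set S) : set R := ideal_gen (valS @` I).

Lemma ext_ideal I : ideal (ext I). Proof. exact: ideal_gen_ideal. Qed.

Lemma ext_val (I : set S) s : I s -> ext I (valS s).
Proof. by move=> Is; apply: sub_ideal_gen; exists s. Qed.

(** The average of sum_k r_k i_k with i_k in I is sum_k rho(r_k) i_k. *)
Lemma ext_reynolds I x : ideal I -> ext I x -> I (reynolds x).
Proof.
(* Being stable under multiplication by R is what makes an ideal of the set of
   all such x. *)
move=> iI Ix; suff : forall r, I (reynolds (r * x)) by move/(_ 1); rewrite mul1r.
move: x Ix; apply: ideal_gen_sub => [|_ [s Is <-] r].
  split=> [r|a x y hx hy r]; first by rewrite mulr0 reynolds0; exact: ideal0.
  by rewrite mulrDr mulrA reynoldsD; exact: idealD.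
by rewrite mulrC reynoldsM mulrC; exact: idealM.
Qed.

Lemma ext_contract I s : ideal I -> ext I (valS s) -> I s.
Proof. by move=> iI /(ext_reynolds iI); rewrite reynolds_val. Qed.

Lemma ext_aut I g x : G g -> ext I x -> ext I (g x).
Proof.
move=> Gg; move: x; apply: (@ideal_gen_sub _ _ (g @^-1` ext I)).
  exact: ideal_preimage (ext_ideal I).
by move=> _ [s Is <-]; rewrite /preimage /= invariantE //; exact: ext_val.
Qed.

Lemma prod_congr (K : set R) (T : eqType) (r : seq T) (F : T -> R) c :
  ideal K -> (forall i, i \in r -> K (F i)) ->
  K (\prod_(i <- r) (c - F i) - c ^+ size r).
Proof.
move=> iK; elim: r => [|i r IH] KF /=; first by rewrite big_nil subrr; exact: ideal0.
rewrite big_cons exprS; have {}IH := IH (fun j jr => KF j (mem_behead (s := i :: r) jr)).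
set p := \prod_(_ <- _) _ in IH *.
have -> : (c - F i) * p - c * c ^+ size r
  = c * (p - c ^+ size r) - p * F i by ring.
by apply: idealB => //; apply: idealM => //; apply: KF; rewrite mem_head.
Qed.

(** Going up and lying over at once.  If s in S is i + e with i in I and e in QR,
    then the norm of i = s - e lies in I and in s^|G| + QR; as I and QR contract
    into Q, the power s^|G| is in Q. *)
Lemma exists_prime_over (I : set R) (Q : set S) :
  ideal I -> prime_ideal Q -> valS @^-1` I `<=` Q ->
  exists P, [/\ prime_ideal P, I `<=` P & valS @^-1` P = Q].
Proof.
move=> iI pQ IQ; have [iQ Q1 _] := pQ.
have [|_ _ [s ns <-] [t nt <-]|x [i Ii [e Qe <-]] [s nQs es]|P [pP KP PX]] :=
  @exists_prime_disjoint R _ (valS @` ~` Q) (ideal_add iI (ext_ideal Q)).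
- by exists 1.
- by exists (s * t) => // /(primeM pQ)[].
- have iE : i = valS s - e by rewrite es addrK.
  apply: nQs; apply: (@primeX _ Q s (size sG)) => //.
  have Qn : Q (norm i) by apply: IQ; exact: norm_ideal.
  rewrite -(subKr (norm i) (s ^+ _)); apply: idealB => //.
  apply: ext_contract => //; rewrite rmorphB rmorphXn /= iE.
  under eq_big_seq => g /mem_sG Gg do rewrite rmorphB /= invariantE //.
  apply: (@prod_congr (ext Q) _ sG (fun g => g e) (valS s) (ext_ideal Q)) => g.
  by move/mem_sG/ext_aut; apply.
- exists P; split=> //.
    move=> x Ix; apply: KP; exists x => //; exists 0; rewrite ?addr0 //.
    exact: ideal0 (ext_ideal _).
  apply/seteqP; split=> [s Ps|s Qs].
    by apply: contrapT => nQs; apply: (PX _ Ps); exists s.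
  apply: KP; exists 0; first exact: ideal0.
  by exists (valS s); rewrite ?add0r //; exact: ext_val.
Qed.
Lemma noetherian_invariant : noetherian R -> noetherian S.
Proof.
move=> nR I iI; have [r [rI Ir]] := noetherian_generators (valS @` I) nR.
have [t tr tI] : exists2 t : seq S, r = [seq valS s | s <- t] & [set` t] `<=` I.
  elim: r rI {Ir} => [|x r IH] rI; first by exists [::].
  have [s Is sx] : (valS @` I) x by apply: rI; rewrite /= mem_head.
  have [|t -> tI] := IH; first by move=> y yr; apply: rI; rewrite /= inE orbC [_ \in _]yr.
  exists (s :: t); first by rewrite -sx.
  by move=> u /=; rewrite inE => /orP[/eqP->|/tI].
exists t; apply/seteqP; split; last exact: ideal_gen_sub.
move=> s Is; have iT := @ideal_gen_ideal _ [set` t].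
apply: (ext_contract iT); move: (Ir _ (ext_val Is)).
apply: ideal_gen_sub; first exact: ext_ideal.
rewrite tr => _ /mapP[u ut ->]; apply: ext_val; exact: sub_ideal_gen.
Qed.

(** A chain of primes of S lifts to R step by step, and the lifted chain is strict
    because its contractions are. *)
Lemma dim_le1_invariant : dim_le1 R -> dim_le1 S.
Proof.
move=> d1 Q0 Q1 Q2 q0 q1 q2 [s01 n01] [s12 n12].
have [|P0 [p0 _ e0]] := exists_prime_over (@ideal_zero R) q0.
  move=> s s0; have -> : s = 0 by exact: val_inj.
  exact: ideal0 (prime_ideal_ideal q0).
have [|P1 [p1 P01 e1]] := exists_prime_over (prime_ideal_ideal p0) q1.
  by rewrite e0.
have [|P2 [p2 P12 e2]] := exists_prime_over (prime_ideal_ideal p1) q2.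
  by rewrite e1.
apply: (d1 P0 P1 P2) => //; split=> // h.
  by apply: n01; rewrite -e0 -e1 => s; exact: h.
by apply: n12; rewrite -e1 -e2 => s; exact: h.
Qed.

Lemma maximal_over (M : set S) : maximal_ideal M ->
  exists N, maximal_ideal N /\ valS @^-1` N = M.
Proof.
move=> mM; have pM := maximal_prime mM.
have [|P [pP _ eP]] := exists_prime_over (@ideal_zero R) pM.
  move=> s s0; have -> : s = 0 by exact: val_inj.
  exact: ideal0 (prime_ideal_ideal pM).
have [iP P1 _] := pP; have [N [mN PN]] := exists_maximal_above iP P1.
exists N; split=> //; have [_ _ Mm] := mM.
have [iN N1 _] := prime_preimage valS (maximal_prime mN).
case: (Mm _ iN) => // [s|NT]; first by rewrite -eP; exact: PN.
by case: N1; rewrite NT.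
Qed.

Lemma semilocal_invariant : semilocal R -> semilocal S.
Proof.
move=> sR; apply: (@sub_finite_set _ _
  ((fun N : set R => valS @^-1` N) @` [set N | maximal_ideal N])).
  by move=> M /= /maximal_over[N [mN eN]]; exists N.
exact: finite_image.
Qed.

Lemma invariant_jacobson_nzd :
  (exists y, nzd R y /\ forall N, maximal_ideal N -> N y) ->
  exists t, nzd R (valS t) /\ forall M, maximal_ideal M -> M t.
Proof.
move=> [y [ny Jy]]; exists (norm y); split; first exact: norm_nzd.
move=> M /maximal_over[N [mN <-]].
by apply: norm_ideal; [exact: maximal_ideal_ideal|exact: Jy].
Qed.

Lemma one_dim_cm_invariant : one_dim_cm_semilocal R -> one_dim_cm_semilocal S.
Proof.
move=> /one_dim_cm_semilocalP[nR sR d1 /invariant_jacobson_nzd[t [nt Jt]]].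
apply/one_dim_cm_semilocalP; split.
- exact: noetherian_invariant.
- exact: semilocal_invariant.
- exact: dim_le1_invariant.
- by exists t; split=> //; exact: val_nzd.
Qed.

(** By the dimension of S, a non-zerodivisor of S divides a power of the norm of a
    non-zerodivisor of R. *)
Lemma nzd_val s : one_dim_cm_semilocal R -> nzd S s -> nzd R (valS s).
Proof.
move=> /one_dim_cm_semilocalP[nR sR d1 /invariant_jacobson_nzd[t [nt Jt]]] ns.
have [n [r e]] := jacobson_power (dim_le1_invariant d1) ns Jt.
have /(congr1 valS) := e; rewrite rmorphXn rmorphM /= => {}e x y sxy.
have ntn : nzd R (valS t ^+ n) by exact: lregX.
by apply: ntn; rewrite e mulrAC sxy mulrAC.
Qed.

End Invariants.

(** * Integral closure of ideals *)

Section IdealProducts.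
Variable A : comNzRingType.
Implicit Types (I J K L : set A) (x y z : A).

Lemma ideal_mul_ideal I J : ideal (ideal_mul I J).
Proof. exact: ideal_gen_ideal. Qed.

Lemma ideal_mul_in I J x y : I x -> J y -> ideal_mul I J (x * y).
Proof. by move=> Ix Jy; apply: sub_ideal_gen; exists x => //; exists y. Qed.

Lemma ideal_mul_sub I J K : ideal K -> (forall x y, I x -> J y -> K (x * y)) ->
  ideal_mul I J `<=` K.
Proof.
by move=> iK h; apply: ideal_gen_sub => // _ [x Ix [y Jy <-]]; exact: h.
Qed.

Lemma ideal_pow_ideal I n : ideal (ideal_pow I n).
Proof. by case: n => [|n]; [exact: ideal_setT|exact: ideal_mul_ideal]. Qed.

Lemma ideal_powX I x n : I x -> ideal_pow I n (x ^+ n).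
Proof.
move=> Ix; elim: n => [//|n IH]; rewrite exprS.
exact: ideal_mul_in.
Qed.

Lemma ideal_powD I m n x y :
  ideal_pow I m x -> ideal_pow I n y -> ideal_pow I (m + n) (x * y).
Proof.
move=> + Jy; elim: m x => [x _|m IH]; first exact: (idealM x (ideal_pow_ideal I n)).
apply: (@ideal_mul_sub _ _ [set x | ideal_pow I (m.+1 + n) (x * y)]).
  exact: (ideal_colon y (ideal_pow_ideal I _)).
move=> k l Ik Il; rewrite /mkset -mulrA addSn; apply: ideal_mul_in => //.
exact: IH.
Qed.

Lemma ideal_pow_le I m n : (m <= n)%N -> ideal_pow I n `<=` ideal_pow I m.
Proof.
move=> mn; rewrite -(subnK mn); elim: (n - m)%N => [//|k IH].
apply: ideal_mul_sub; first exact: ideal_pow_ideal.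
by move=> x y _ /IH; exact: (idealM x (ideal_pow_ideal I m)).
Qed.

Lemma ideal_mul_gen K (s : seq A) x : ideal K ->
  ideal_mul K (ideal_gen [set` s]) x ->
  exists c : 'I_(size s) -> A, (forall i, K (c i)) /\ x = \sum_i c i * s`_i.
Proof.
move=> iK; pose C := [set x | exists c : 'I_(size s) -> A,
  (forall i, K (c i)) /\ x = \sum_i c i * s`_i].
have iC : ideal C.
  split.
    exists (fun=> 0); split=> [i|]; first exact: ideal0.
    by rewrite big1 // => i _; rewrite mul0r.
  move=> a _ _ [c [Kc ->]] [d [Kd ->]]; exists (fun i => a * c i + d i).
  split=> [i|]; first by case: iK => _; apply.
  by rewrite mulr_sumr -big_split; apply: eq_bigr => i _; rewrite /= mulrDl mulrA.
suff : ideal_mul K (ideal_gen [set` s]) `<=` C by apply.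
apply: ideal_mul_sub => // k l Kk; rewrite mulrC; move: l.
apply: (ideal_gen_sub (ideal_colon k iC)) => y ys.
have js : (index y s < size s)%N by rewrite index_mem.
exists (fun i => if i == Ordinal js then k else 0); split.
  by move=> i; case: eqP => // _; exact: ideal0.
rewrite (bigD1 (Ordinal js)) //= eqxx nth_index // mulrC big1 ?addr0 //.
by move=> i /negbTE ->; rewrite mul0r.
Qed.

End IdealProducts.

Section DeterminantTrick.
Variable A : comNzRingType.
Variable K : set A.
Hypothesis iK : ideal K.
Implicit Types (p q : {poly A}) (x z : A) (L : set A).

(** The part of weight d of the Rees algebra of K with X in weight one; K^(d - i)
    is the whole ring when i exceeds d. *)
Definition rees_weight d p := forall i, ideal_pow K (d - i) p`_i.

Lemma rees_weightM d e p q :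
  rees_weight d p -> rees_weight e q -> rees_weight (d + e) (p * q).
Proof.
move=> hp hq i; rewrite coefM; apply: ideal_sum => [|[j /= ji] _].
  exact: ideal_pow_ideal.
apply: ideal_pow_le (ideal_powD (hp j) (hq (i - j)%N)); lia.
Qed.

Lemma rees_weight_sum d (T : Type) (r : seq T) (F : T -> {poly A}) :
  (forall i, rees_weight d (F i)) -> rees_weight d (\sum_(i <- r) F i).
Proof.
move=> hF i; rewrite coef_sum; apply: ideal_sum => [|j _]; last exact: hF.
exact: ideal_pow_ideal.
Qed.

Lemma rees_weight_prod n (F : 'I_n -> {poly A}) :
  (forall i, rees_weight 1 (F i)) -> rees_weight n (\prod_i F i).
Proof.
elim: n F => [|n IH] F hF; first by rewrite big_ord0.
by rewrite big_ord_recl; apply: (@rees_weightM 1 n) => //; apply: IH.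
Qed.

Lemma char_poly_rees n (M : 'M[A]_n) :
  (forall i j, K (M i j)) -> rees_weight n (char_poly M).
Proof.
move=> KM; apply: rees_weight_sum => s.
apply: (@rees_weightM 0 n) => [//|]; apply: rees_weight_prod => i [|j]; last first.
  by rewrite subSS sub0n.
rewrite !mxE coefB coefMn coefX coefC /= mul0rn sub0r.
apply: (idealN (I := ideal_pow K 1)); first exact: ideal_pow_ideal.
by rewrite -[M _ _]mulr1; exact: ideal_mul_in.
Qed.

(** Multiplication by x on L is given by a matrix with entries in K; its
    characteristic polynomial at x kills L, hence vanishes. *)
Lemma determinant_trick L x z : noetherian A -> ideal L -> L z -> nzd A z ->
  (forall l, L l -> ideal_mul K L (x * l)) ->
  exists f, [/\ f \is monic, f.[x] = 0 & rees_weight (size f).-1 f].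
Proof.
move=> nA iL Lz nz xL; have [s es] := nA L iL.
have /choice[c cP] (i : 'I_(size s)) : exists c : 'I_(size s) -> A,
    (forall j, K (c j)) /\ x * s`_i = \sum_j c j * s`_j.
  apply: ideal_mul_gen => //; rewrite -es; apply: xL; rewrite es.
  by apply: sub_ideal_gen; exact: mem_nth.
pose M := \matrix_(i, j) c i j; pose N := x%:M - M.
pose v := \col_i s`_i : 'cV[A]_(size s).
have Nv : N *m v = 0.
  rewrite mulmxBl mul_scalar_mx; apply/colP => i; rewrite !mxE (cP i).2 -sumrB.
  by rewrite big1 // => j _; rewrite !mxE subrr.
have dN : (char_poly M).[x] = \det N.
  rewrite /char_poly -/(horner_eval x _) -det_map_mx; congr (\det _).
  by apply/matrixP => i j; rewrite !mxE rmorphB rmorphMn /= /horner_eval hornerX hornerC.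
exists (char_poly M); split; first exact: char_poly_monic.
- rewrite dN; apply: nz; rewrite mulr0.
  move: Lz; rewrite es; apply: (ideal_gen_sub (ideal_colon (\det N) (@ideal_zero A))) => y /=.
  move=> ys; have js : (index y s < size s)%N by rewrite index_mem.
  have : \det N *: v = 0 by rewrite -mul_scalar_mx -mul_adj_mx -mulmxA Nv mulmx0.
  by move=> /colP/(_ (Ordinal js)); rewrite !mxE /= nth_index // mulrC.
- by rewrite size_char_poly; apply: char_poly_rees => i j; rewrite mxE; case: (cP i).
Qed.

End DeterminantTrick.

Section IntegralClosure.
Variable A : comNzRingType.
Implicit Types (I J K L : set A) (x y z : A).

(** Over a Noetherian ring, and for K containing a non-zerodivisor, this is the
    integral closure of K.  Unlike equations of integral dependence, the ideals L
    with x L in K L can be multiplied together. *)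
Definition icl K : set A := [set x | exists L,
  [/\ ideal L, exists2 z, L z & nzd A z & forall l, L l -> ideal_mul K L (x * l)]].

Lemma sub_icl K : ideal K -> K `<=` icl K.
Proof.
move=> iK x Kx; exists setT; split=> //; first by exists 1 => //; exact: nzd1.
by move=> l _; exact: ideal_mul_in.
Qed.

Lemma ideal_mulA_in K L L' y z :
  ideal_mul K L y -> L' z -> ideal_mul K (ideal_mul L L') (y * z).
Proof.
move=> + Lz; move: y.
apply: (ideal_mul_sub (K := [set y | ideal_mul K (ideal_mul L L') (y * z)])).
  exact: (ideal_colon z (ideal_mul_ideal K _)).
by move=> k l Kk Ll /=; rewrite -mulrA; apply: ideal_mul_in => //; exact: ideal_mul_in.
Qed.

Lemma ideal_mulC I J : ideal_mul I J = ideal_mul J I.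
Proof.
apply/seteqP; split; apply: ideal_mul_sub; try exact: ideal_mul_ideal.
  by move=> x y Ix Jy; rewrite mulrC; exact: ideal_mul_in.
by move=> x y Ix Jy; rewrite mulrC; exact: ideal_mul_in.
Qed.

Lemma ideal_mul_nzd L L' : (exists2 z, L z & nzd A z) ->
  (exists2 z, L' z & nzd A z) -> exists2 z, ideal_mul L L' z & nzd A z.
Proof.
move=> [z Lz nz] [w Lw nw]; exists (z * w); first exact: ideal_mul_in.
exact: nzdM.
Qed.

(** The product of the ideals that serve for x and for y serves for x + y. *)
Lemma icl_ideal K : ideal K -> ideal (icl K).
Proof.
move=> iK; split; first by apply: sub_icl => //; exact: ideal0.
move=> a x y [L [iL nL xL]] [L' [iL' nL' yL']].
exists (ideal_mul L L'); split; [exact: ideal_mul_ideal|exact: ideal_mul_nzd|].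
have iM := ideal_mul_ideal K (ideal_mul L L').
move=> l; rewrite mulrC; move: l; apply: ideal_mul_sub.
  exact: (ideal_colon (a * x + y) iM).
move=> l l' Ll Ll' /=.
have -> : l * l' * (a * x + y) = a * (x * l * l') + y * l' * l by ring.
apply: (idealD iM); first by apply: (idealM a iM); apply: ideal_mulA_in => //; exact: xL.
by rewrite (ideal_mulC L); apply: ideal_mulA_in => //; exact: yL'.
Qed.

Lemma icl_common K (s : seq A) : ideal K -> [set` s] `<=` icl K ->
  exists L, [/\ ideal L, exists2 z, L z & nzd A z &
    forall x l, ideal_gen [set` s] x -> L l -> ideal_mul K L (x * l)].
Proof.
move=> iK; elim: s => [|y s IH] sK.
  exists setT; split=> //; first by exists 1 => //; exact: nzd1.
  move=> x l /ideal_gen_nil -> _; rewrite mul0r; exact: (ideal0 (ideal_mul_ideal _ _)).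
have [|L [iL nL sL]] := IH; first by move=> z zs; apply: sK; rewrite /= inE orbC [_ \in _]zs.
have [|L' [iL' nL' yL']] := sK y; first by rewrite /= mem_head.
have iM := ideal_mul_ideal K (ideal_mul L L').
exists (ideal_mul L L'); split; [exact: ideal_mul_ideal|exact: ideal_mul_nzd|].
move=> x l + Ll; move: x; apply: ideal_gen_sub; first exact: (ideal_colon l iM).
move=> z /=; rewrite inE mulrC => zys; move: l Ll; apply: ideal_mul_sub.
  exact: (ideal_colon z iM).
move=> l l' Ll Ll' /=; case/orP: zys => [/eqP->|zs].
  have -> : l * l' * y = y * l' * l by ring.
  by rewrite (ideal_mulC L); apply: ideal_mulA_in => //; exact: yL'.
have -> : l * l' * z = z * l * l' by ring.
by apply: ideal_mulA_in => //; apply: sL => //; exact: sub_ideal_gen.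
Qed.

(** Let x L' lie in K' L' for the closure K' of K, and let L be an ideal common to
    the finitely many generators of K'.  Then L L' serves for x. *)
Lemma icl_icl K : noetherian A -> ideal K -> icl (icl K) `<=` icl K.
Proof.
move=> nA iK x [L' [iL' nL' xL']].
have [s es] := nA _ (icl_ideal iK).
have [|L [iL nL sL]] := @icl_common K s iK.
  by rewrite es; exact: sub_ideal_gen.
have iM := ideal_mul_ideal K (ideal_mul L L').
exists (ideal_mul L L'); split; [exact: ideal_mul_ideal|exact: ideal_mul_nzd|].
move=> l; rewrite mulrC; move: l; apply: ideal_mul_sub.
  exact: (ideal_colon x iM).
move=> l l' Ll Ll' /=; have -> : l * l' * x = x * l' * l by ring.
move: (xL' _ Ll').
apply: (ideal_mul_sub (K := [set w | ideal_mul K (ideal_mul L L') (w * l)])).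
  exact: (ideal_colon l iM).
move=> j m Jj Lm /=; have -> : j * m * l = j * l * m by ring.
by apply: ideal_mulA_in => //; apply: sL => //; rewrite -es.
Qed.

(** For an equation of degree n the ideal L = sum_(i < n) K^(n - 1 - i) x^i
    serves. *)
Lemma integral_icl K x : ideal K -> (exists2 z, K z & nzd A z) ->
  integral_over_ideal K x -> icl K x.
Proof.
move=> iK [z Kz nz] [n [a [n0 Ka e]]].
pose X := [set y | exists i c, [/\ (i < n)%N, ideal_pow K (n.-1 - i) c &
  y = c * x ^+ i]].
pose L := ideal_gen X.
have iKL := ideal_mul_ideal K L.
have shift m j c : (m + j)%N = n.-1 -> ideal_pow K m.+1 c ->
    ideal_mul K L (c * x ^+ j).
  move=> mj; move: c.
  apply: (ideal_mul_sub (K := [set c | ideal_mul K L (c * x ^+ j)])).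
    exact: (ideal_colon _ iKL).
  move=> k c Kk Kc /=; rewrite -mulrA; apply: ideal_mul_in => //.
  apply: sub_ideal_gen; exists j, c; split=> //; first lia.
  by have -> : (n.-1 - j)%N = m by lia.
exists L; split; first exact: ideal_gen_ideal.
  exists (z ^+ n.-1); last exact: lregX.
  apply: sub_ideal_gen; exists 0%N, (z ^+ n.-1); split; rewrite ?mulr1 //.
  by rewrite subn0; exact: ideal_powX.
move=> l; rewrite mulrC; move: l; apply: ideal_gen_sub.
  exact: (ideal_colon x iKL).
move=> _ [i [c [iltn Kc ->]]] /=; rewrite -mulrA -exprSr.
have [i1|i1] := ltnP i.+1 n.
  apply: (shift (n.-1 - i.+1)%N); first lia.
  by have -> : (n.-1 - i.+1).+1 = (n.-1 - i)%N by lia.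
have -> : i.+1 = n by lia.
have -> : x ^+ n = - \sum_(1 <= i < n.+1) a i * x ^+ (n - i).
  by apply/eqP; rewrite -addr_eq0 e.
apply: (idealM c iKL); apply: (idealN iKL).
rewrite big_seq_cond; apply: ideal_sum => // j.
rewrite mem_index_iota andbT => /andP[j1 jn].
by apply: (shift j.-1); [lia|rewrite prednK //; apply: Ka; lia].
Qed.

Lemma icl_integrally_closed K : noetherian A -> ideal K ->
  (exists2 z, K z & nzd A z) -> integrally_closed_ideal (icl K).
Proof.
move=> nA iK [z Kz nz]; split; first exact: icl_ideal.
move=> x xK; apply: icl_icl => //; apply: integral_icl => //.
  exact: icl_ideal.
by exists z => //; exact: sub_icl.
Qed.

Lemma icl_poly K x : noetherian A -> ideal K -> icl K x ->
  exists f : {poly A}, [/\ f \is monic, f.[x] = 0 & rees_weight K (size f).-1 f].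
Proof.
by move=> nA iK [L [iL [z Lz nz] xL]]; apply: (determinant_trick iK nA iL Lz nz xL).
Qed.

End IntegralClosure.

(** * Integral fractions *)

Lemma nzdX (A : comNzRingType) (x : A) n : nzd A x -> nzd A (x ^+ n).
Proof. exact: lregX. Qed.

Lemma nzd_eq0 (A : comNzRingType) (x y : A) : nzd A x -> x * y = 0 -> y = 0.
Proof. by move=> nx xy; apply: nx; rewrite xy mulr0. Qed.

Lemma monic_size (A : comNzRingType) (f : {poly A}) : f \is monic ->
  exists2 n, size f = n.+1 & f`_n = 1.
Proof.
move=> mf; exists (size f).-1; last by have /monicP := mf.
by rewrite prednK // lt0n size_poly_eq0 monic_neq0.
Qed.

Section IntegralFractions.
Variable A : comNzRingType.
Implicit Types x y j a : A.

(** The value of x^(deg f) f(y / x) with denominators cleared. *)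
Definition homogeneous_eval (f : {poly A}) x y :=
  \sum_(i < size f) f`_i * (y ^+ i * x ^+ ((size f).-1 - i)).

Lemma integral_fracP x y (hx : nzd A x) : integral_over_base (frac y hx) <->
  exists2 f, f \is monic & homogeneous_eval f x y = 0.
Proof.
have key f : f \is monic -> tofrac (nzd A) x ^+ (size f).-1 *
    (map_poly (tofrac (nzd A)) f).[frac y hx] = tofrac _ (homogeneous_eval f x y).
  move=> mf; rewrite horner_coef size_map_poly_id0; last first.
    by rewrite (monicP mf) rmorph1 oner_neq0.
  rewrite mulr_sumr rmorph_sum; apply: eq_bigr => i _ /=.
  rewrite coef_map !rmorphM !rmorphXn /= [tofrac _ y](tofrac_frac _ hx).
  have -> : (size f).-1 = (i + ((size f).-1 - i))%N by have := ltn_ord i; lia.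
  rewrite exprD addKn exprMn; ring.
split=> [[f mf /rootP rf]|[f mf ef]]; exists f => //.
  have := key f mf; rewrite rf mulr0 => /esym e0.
  have /(tofrac_eq _ _ 0)[u [nu]] : tofrac (nzd A) (homogeneous_eval f x y) = tofrac _ 0.
    by rewrite e0 rmorph0.
  by rewrite mulr0; exact: nzd_eq0.
apply/rootP; have := key f mf; rewrite ef rmorph0 => e0.
by apply: (nzd_eq0 _ e0); apply: nzdX; exact: tofrac_regular.
Qed.

Lemma ideal_pow_principal a n c :
  ideal_pow (range ( *%R a)) n c -> exists r, c = a ^+ n * r.
Proof.
elim: n c => [|n IH] c; first by exists c; rewrite mul1r.
apply: (ideal_mul_sub (K := [set c | exists r, c = a ^+ n.+1 * r])).
  split=> [|s _ _ [r ->] [r' ->]]; first by exists 0; rewrite mulr0.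
  by exists (s * r + r'); ring.
move=> _ d [r _ <-] /IH[r' ->]; exists (r * r'); rewrite exprS; ring.
Qed.

(** In the determinant trick for the ideal (a), the coefficient of X^i is divisible
    by the power of a that makes the equation homogeneous. *)
Lemma integral_quotient L a j : noetherian A -> ideal L ->
  (exists2 z, L z & nzd A z) ->
  (forall l, L l -> exists2 r, L r & j * l = a * r) ->
  exists2 f, f \is monic & homogeneous_eval f a j = 0.
Proof.
move=> nA iL [z Lz nz] jL.
have [|f [mf ef wf]] := determinant_trick (ideal_principal a) nA iL Lz nz (x := j).
  by move=> l /jL[r Lr ->]; apply: ideal_mul_in => //; exists 1; rewrite ?mulr1.
have [N Nf fN] := monic_size mf; rewrite Nf /= in wf.
have /choice[r rP] i : exists r, f`_i = a ^+ (N - i) * r.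
  exact: ideal_pow_principal.
have rN : r N = 1 by have := rP N; rewrite subnn mul1r fN.
have sg : size (\poly_(i < N.+1) r i) = N.+1.
  by rewrite size_poly_eq // rN oner_neq0.
exists (\poly_(i < N.+1) r i); first by rewrite monicE lead_coefE sg coef_poly ltnSn rN.
rewrite /homogeneous_eval sg -[RHS]ef horner_coef Nf; apply: eq_bigr => i _.
rewrite coef_poly ltn_ord rP /=; ring.
Qed.

End IntegralFractions.

(** * Integral extensions *)

Section IntegralExtension.
Variables (A B : comNzRingType) (f : {rmorphism A -> B}).
Hypothesis intf : forall u, integralOver f u.

(** Suppose that u is neither in P nor invertible modulo P.  If a polynomial over A
    has a value at u in P, its constant coefficient is a multiple of u modulo P,
    hence lies in the maximal ideal below P; after division by u the same holds
    for all other coefficients.  A monic polynomial cannot be of this kind. *)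
Lemma integral_inv_mod (P : set B) u : prime_ideal P ->
  maximal_ideal (f @^-1` P) -> ~ P u -> exists c, P (1 - u * c).
Proof.
move=> pP mP nPu; apply: contrapT => no; have [iP P1 _] := pP.
have coefP (p : {poly A}) : P (map_poly f p).[u] -> forall i, P (f p`_i).
  elim/poly_ind: p => [|p c IH]; first by move=> _ i; rewrite coef0 rmorph0; exact: ideal0.
  rewrite rmorphD rmorphM /= map_polyX map_polyC /= hornerMXaddC => Ppc.
  have Pc : P (f c).
    apply: contrapT => nPc; have [s] := maximal_inv mP nPc.
    rewrite /preimage /= rmorphB rmorph1 rmorphM => Pcs; apply: no.
    exists (- ((map_poly f p).[u] * f s)).
    have -> : 1 - u * - ((map_poly f p).[u] * f s) =
      f s * ((map_poly f p).[u] * u + f c) + (1 - f c * f s) by ring.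
    by apply: (idealD iP) => //; exact: (idealM _ iP).
  have Pp : P (map_poly f p).[u].
    have : P ((map_poly f p).[u] * u) by rewrite -[_ * u](addrK (f c)); exact: idealB.
    by case/(primeM pP).
  move=> [|i]; rewrite coefD coefMX coefC ?add0r //= addr0; exact: IH.
have [p mp /rootP ep] := intf u.
have := coefP p; rewrite ep => /(_ (ideal0 iP) (size p).-1).
by have /monicP := mp; rewrite /lead_coef => ->; rewrite rmorph1.
Qed.

(** If f y were invertible modulo a maximal ideal with inverse u, an integral
    equation of u multiplied by a power of y would say that 1 + y e lies in the
    maximal ideal for some e in A. *)
Lemma integral_jacobson (n : set B) y : maximal_ideal n ->
  (forall M : set A, maximal_ideal M -> M y) -> n (f y).
Proof.
move=> mn Jy; apply: contrapT => /(maximal_inv mn)[u nu].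
have iN := maximal_ideal_ideal mn.
have leadP (p : {poly A}) : exists k e,
    n (f y ^+ k * (map_poly f p).[u] - f (lead_coef p + y * e)).
  elim/poly_ind: p => [|p c [k [e IH]]].
    exists 0%N, 0; rewrite rmorph0 horner0 lead_coef0 !mulr0 addr0 rmorph0 subrr.
    exact: ideal0.
  have [->|p0] := eqVneq p 0.
    exists 0%N, 0; rewrite mul0r add0r map_polyC hornerC lead_coefC.
    by rewrite mul1r mulr0 addr0 subrr; exact: ideal0.
  have lp : lead_coef (p * 'X + c%:P) = lead_coef p.
    rewrite lead_coefDl ?lead_coefMX // size_mulX //.
    by rewrite (leq_ltn_trans (size_polyC_leq1 c)) // ltnS lt0n size_poly_eq0.
  exists k.+1, (e + y ^+ k * c); rewrite lp.
  rewrite rmorphD rmorphM /= map_polyX map_polyC /= hornerMXaddC.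
  set w := _.[u] in IH *.
  have -> : f y ^+ k.+1 * (w * u + f c) - f (lead_coef p + y * (e + y ^+ k * c))
    = (f y ^+ k * w - f (lead_coef p + y * e)) - f y ^+ k * w * (1 - f y * u).
    by rewrite !(rmorphD, rmorphM) /= rmorphXn exprS; ring.
  by apply: (idealB iN) => //; exact: (idealM _ iN).
have [p mp /rootP ep] := intf u.
have [k [e]] := leadP p; rewrite ep mulr0 sub0r (monicP mp) => h.
have [M mM Me|d de] := @jacobson_unit _ (1 + y * e).
  apply: (maximal_proper mM).
  rewrite -[1](addrK (y * e)); apply: (idealB (maximal_ideal_ideal mM)) => //.
  by rewrite mulrC; apply: idealM; [exact: maximal_ideal_ideal|exact: Jy].
apply: (maximal_proper mn).
have -> : 1 = - f d * - f (1 + y * e) :> B.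
  by rewrite mulrNN -rmorphM [d * _]mulrC de rmorph1.
exact: idealM.
Qed.

(** Modulo f y, the ring B is zero-dimensional, hence every u is a unit on a
    clopen part of the spectrum and nilpotent on the other part. *)
Lemma integral_split_power y u : dim_le1 A -> nzd A y ->
  (forall M : set A, maximal_ideal M -> M y) ->
  exists n c d, u ^+ n * (1 - u * c) = f y * d.
Proof.
move=> d1 ny Jy; apply: contrapT => no.
pose X := [set z : B | exists n c, z = u ^+ n * (1 - u * c)].
have [||z [d _ <-] [n [c e]]|P [pP yP PX]] :=
  @exists_prime_disjoint B _ X (ideal_principal (f y)).
- by exists 0%N, 0; rewrite mulr0 subr0 mulr1.
- move=> _ _ [n [c ->]] [m [d ->]]; exists (n + m)%N, (c + d - u * c * d).
  by rewrite exprD; ring.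
- by apply: no; exists n, c, d.
have Py : P (f y) by apply: yP; exists 1; rewrite ?mulr1.
have pfP := prime_preimage f pP.
have mP := dim_le1_maximal d1 pfP Py (nzd_regular_at pfP ny).
have nPu : ~ P u.
  by move=> Pu; apply: (PX u Pu); exists 1%N, 0; rewrite mulr0 subr0 mulr1.
have [c Pc] := integral_inv_mod pP mP nPu.
by apply: (PX _ Pc); exists 0%N, c; rewrite mul1r.
Qed.

End IntegralExtension.

(** * The ring of quotients of a stable ideal *)

(** The last condition says that J^2 = a J, so that the fractions j / a with j in J
    form a ring. *)
Record stable_ideal (A : comNzRingType) := StableIdeal {
  stable_set :> A -> Prop;
  stable_gen : A;
  stable_idealP : ideal stable_set;
  stable_genP : stable_set stable_gen;
  stable_gen_nzd : nzd A stable_gen;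
  stable_mulP : forall x y, stable_set x -> stable_set y ->
    exists z, stable_set z /\ stable_gen * z = x * y
}.

Arguments stable_gen_nzd {A} s.

Section StableRing.
Variables (A : comNzRingType) (J : stable_ideal A).
Local Notation a := (stable_gen J).

Definition stable_pred : {pred A} := fun x => `[< J x >].

(** The element x stands for the fraction x / a, a being the generator. *)
Record stable_ring := StableRing {
  stable_val :> A;
  stable_valP : stable_val \in stable_pred
}.

HB.instance Definition _ := [isSub for stable_val].
HB.instance Definition _ := [Choice of stable_ring by <:].

Fact stable_zmod_closed : zmod_closed stable_pred.
Proof.
have iJ := stable_idealP J; split; first by apply/asboolP; exact: ideal0.
by move=> x y /asboolP Jx /asboolP Jy; apply/asboolP; exact: idealB.
Qed.

HB.instance Definition _ :=
  GRing.SubChoice_isSubZmodule.Build A stable_pred stable_ring stable_zmod_closed.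

Lemma stable_in (u : stable_ring) : J (stable_val u).
Proof. exact/asboolP/stable_valP. Qed.

Definition stable_of x (Jx : J x) : stable_ring := StableRing (introT (asboolP _) Jx).

Definition stable_mul (u v : stable_ring) : stable_ring :=
  stable_of (projT2 (cid (stable_mulP (stable_in u) (stable_in v)))).1.

Fact stable_mul_val u v : a * stable_val (stable_mul u v) = stable_val u * stable_val v.
Proof. exact: (projT2 (cid (stable_mulP (stable_in u) (stable_in v)))).2. Qed.

Definition stable_one : stable_ring := stable_of (stable_genP J).

Lemma stable_gen_inj x y : a * x = a * y -> x = y.
Proof. exact: stable_gen_nzd. Qed.

Lemma stable_val_inj : injective stable_val.
Proof. exact: val_inj. Qed.

Fact stable_mulA : associative stable_mul.
Proof.
move=> u v w; apply: stable_val_inj; do 2!apply: stable_gen_inj.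
rewrite !stable_mul_val mulrCA stable_mul_val [RHS]mulrA.
by rewrite stable_mul_val mulrA.
Qed.

Fact stable_mulC : commutative stable_mul.
Proof.
move=> u v; apply: stable_val_inj; apply: stable_gen_inj.
by rewrite !stable_mul_val mulrC.
Qed.

Fact stable_mul1 : left_id stable_one stable_mul.
Proof.
by move=> u; apply: stable_val_inj; apply: stable_gen_inj; rewrite stable_mul_val.
Qed.

Fact stable_mulD : left_distributive stable_mul +%R.
Proof.
move=> u v w; apply: stable_val_inj; apply: stable_gen_inj.
rewrite stable_mul_val -[stable_val (stable_mul _ _ + _)]/(_ + _).
by rewrite mulrDr !stable_mul_val -mulrDl.
Qed.

Fact stable_one_neq0 : stable_one != 0.
Proof.
apply/eqP => /(congr1 stable_val) /= a0.
by apply: (@mulset0 _ (nzd A)); rewrite -a0; exact: stable_gen_nzd.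
Qed.

HB.instance Definition _ := GRing.Zmodule_isComNzRing.Build stable_ring
  stable_mulA stable_mulC stable_mul1 stable_mulD stable_one_neq0.

Lemma stable_valM (u v : stable_ring) :
  a * stable_val (u * v) = stable_val u * stable_val v.
Proof. exact: stable_mul_val. Qed.

Lemma stable_valD (u v : stable_ring) :
  stable_val (u + v) = stable_val u + stable_val v.
Proof. by []. Qed.

Lemma stable_valB (u v : stable_ring) :
  stable_val (u - v) = stable_val u - stable_val v.
Proof. by []. Qed.

Lemma stable_val_sum (T : Type) (r : seq T) (F : T -> stable_ring) :
  stable_val (\sum_(i <- r) F i) = \sum_(i <- r) stable_val (F i).
Proof. exact: (big_morph stable_val stable_valD (erefl _ : stable_val 0 = 0)). Qed.

Lemma stable_valX (u : stable_ring) n :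
  a ^+ n * stable_val (u ^+ n) = a * stable_val u ^+ n.
Proof.
elim: n => [|n IH]; first by rewrite mul1r mulr1.
rewrite exprSr -mulrA [u ^+ _]exprS stable_valM mulrCA IH [in RHS]exprS; ring.
Qed.

Definition stable_scalar (r : A) : stable_ring :=
  stable_of (idealM r (stable_idealP J) (stable_genP J)).

Fact stable_scalar_zmod : zmod_morphism stable_scalar.
Proof. by move=> r s; apply: val_inj; rewrite /= mulrBl. Qed.

Fact stable_scalar_monoid : monoid_morphism stable_scalar.
Proof.
split=> [|r s]; apply: stable_val_inj; first by rewrite /= mul1r.
by apply: stable_gen_inj; rewrite stable_valM /=; ring.
Qed.

HB.instance Definition _ :=
  GRing.isZmodMorphism.Build _ _ stable_scalar stable_scalar_zmod.
HB.instance Definition _ :=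
  GRing.isMonoidMorphism.Build _ _ stable_scalar stable_scalar_monoid.

Lemma stable_scalarM r u : stable_val (stable_scalar r * u) = r * stable_val u.
Proof. by apply: stable_gen_inj; rewrite stable_valM /=; ring. Qed.

(** An element u / a of the ring maps the finitely generated ideal J into itself. *)
Lemma stable_ring_integral : noetherian A ->
  forall u, integralOver stable_scalar u.
Proof.
move=> nA u.
have [|l Jl|f mf ef] := @integral_quotient A J a (stable_val u) nA (stable_idealP J).
- by exists a; [exact: stable_genP|exact: stable_gen_nzd].
- by have [r [Jr e]] := stable_mulP (stable_in u) Jl; exists r.
exists f => //; apply/rootP; apply: stable_val_inj.
have nN : nzd A (a ^+ (size f).-1) by apply: nzdX; exact: stable_gen_nzd.
apply: (nzd_eq0 nN).
rewrite horner_coef size_map_poly_id0; last by rewrite (monicP mf) rmorph1 oner_neq0.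
rewrite stable_val_sum mulr_sumr.
suff -> : \sum_(i < size f) a ^+ (size f).-1 * stable_val
    ((map_poly stable_scalar f)`_i * u ^+ i) = a * homogeneous_eval f a u.
  by rewrite ef mulr0.
rewrite mulr_sumr; apply: eq_bigr => i _.
rewrite coef_map stable_scalarM.
have {1}-> : (size f).-1 = (i + ((size f).-1 - i))%N by have := ltn_ord i; lia.
rewrite exprD.
have -> : a ^+ i * a ^+ ((size f).-1 - i) * (f`_i * stable_val (u ^+ i)) =
  a ^+ ((size f).-1 - i) * f`_i * (a ^+ i * stable_val (u ^+ i)) by ring.
by rewrite stable_valX; ring.
Qed.

End StableRing.

(** * Stable ideals of Arf rings *)

Section ArfStable.
Variable A : comNzRingType.
Hypothesis arfA : arf_ring A.

(** If J^(n+1) = a J^n then all j / a with j in J are integral, so j j' / a lies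
    in the ring; it maps J^n into J^(n+1), hence is integral over J. *)
Lemma arf_stable (J : set A) : integrally_closed_ideal J ->
  (forall x, icl J x -> J x) -> (exists2 z, J z & nzd A z) ->
  exists a, [/\ J a, nzd A a &
    forall x y, J x -> J y -> exists z, J z /\ a * z = x * y].
Proof.
have [[nA _ _] arf1 arf2] := arfA.
move=> [iJ cJ] iclJ [z Jz nz].
have [|n [a [Ja eJ]]] := arf1 J (conj iJ cJ); first by exists z.
have na : nzd A a.
  have : ideal_pow J n.+1 (z ^+ n.+1) by exact: ideal_powX.
  rewrite eJ => -[w _ e] x y axy.
  have nzn : nzd A (z ^+ n.+1) by exact: nzdX.
  by apply: nzn; rewrite -e mulrAC axy mulrAC.
have znJ : exists2 w, ideal_pow J n w & nzd A w.
  by exists (z ^+ n); [exact: ideal_powX|exact: nzdX].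
have intJ j : J j -> integral_over_base (frac j na).
  move=> Jj; apply/integral_fracP.
  apply: (integral_quotient nA (ideal_pow_ideal J n) znJ) => l Jl.
  have : ideal_pow J n.+1 (j * l) by exact: ideal_mul_in.
  by rewrite eJ => -[r Jr <-]; exists r.
(* J^(n+2) = J (a J^n) = a J^(n+1). *)
have step l : ideal_pow J n.+2 l -> exists2 w, ideal_pow J n.+1 w & l = a * w.
  apply: (ideal_mul_sub (K := [set l | exists2 w, ideal_pow J n.+1 w & l = a * w])).
    split=> [|c _ _ [w Jw ->] [w' Jw' ->]].
      by exists 0; rewrite ?mulr0 //; exact: ideal0 (ideal_pow_ideal _ _).
    exists (c * w + w'); last by ring.
    by case: (ideal_pow_ideal J n.+1) => _; apply.
  move=> j m Jj; rewrite -/(ideal_pow J n.+1) => Jm.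
  have [w Jw <-] : [set a * x | x in ideal_pow J n] m by rewrite -eJ.
  by exists (j * w); [exact: ideal_mul_in|ring].
exists a; split=> // x y Jx Jy.
have [r _ er] := arf2 a x y na (intJ x Jx) (intJ y Jy).
have {}er : a * r = x * y.
  have : tofrac (nzd A) (a * r) = tofrac _ (x * y).
    by rewrite rmorphM /= er -tofrac_frac.
  by move/tofrac_eq => [u [nu]]; exact: nu.
exists r; split=> //; apply: iclJ; exists (ideal_pow J n); split=> //.
  exact: ideal_pow_ideal.
move=> l Jl.
have [|w Jw e] := step (x * (y * l)); first by do 2!apply: ideal_mul_in => //.
suff -> : r * l = w by [].
by apply: (na (r * l) w); rewrite -e mulrA er mulrA.
Qed.

End ArfStable.

(** * A generator of a stable ideal among the invariants *)

Section InvariantGenerator.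
Variables (R : comNzRingType) (G : set (ring_aut R)).
Hypothesis hG : finite_subgroup G.
Variable b : R.
Hypothesis hb : b * (group_order G)%:R = 1.
Local Notation S := (invariant_ring G).
Local Notation valS := (@invariant_val R G).
Local Notation rho := (reynolds hG hb).

Hypotheses (nR : noetherian R) (d1 : dim_le1 R).
Variable t : S.
Hypothesis nt : nzd R (valS t).
Hypothesis Jt : forall N : set R, maximal_ideal N -> N (valS t).

Variable J : stable_ideal R.
Hypothesis J_aut : forall g x, G g -> J x -> J (g x).
Variable I : set S.
Hypothesis IJ : forall s, I s <-> J (valS s).

Local Notation a := (stable_gen J).
Local Notation B := (stable_ring J).
Local Notation iJ := (stable_idealP J).

(** That x / a lies in n, stated for elements of R since G acts on x and a
    separately. *)
Definition stable_contains (n : set B) (x : R) : Prop :=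
  exists u, n u /\ stable_val u = x.

(** J is stable under G, so each g a generates J^2 = a J as well. *)
Lemma stable_aut_gen g x y : G g -> J x -> J y -> exists z, J z /\ g a * z = x * y.
Proof.
move=> Gg Jx Jy.
have [x' ex gx] := group_invE x Gg; have [y' ey gy] := group_invE y Gg.
have Jx' : J x' by rewrite ex; apply: J_aut => //; exact: (mem_groupV hG).
have Jy' : J y' by rewrite ey; apply: J_aut => //; exact: (mem_groupV hG).
have [z [Jz e]] := stable_mulP Jx' Jy'.
exists (g z); split; first exact: J_aut.
by rewrite -rmorphM e rmorphM /= gx gy.
Qed.

Lemma stable_aut_genX g x k : G g -> J x ->
  exists z, J z /\ g a ^+ k * x = a ^+ k * z.
Proof.
move=> Gg; elim: k x => [|k IH] x Jx; first by exists x; rewrite !mul1r.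
have [z [Jz e]] := stable_mulP (J_aut Gg (stable_genP J)) Jx.
have [w [Jw e']] := IH z Jz; exists w; split=> //.
by rewrite !exprS -mulrA mulrCA -e mulrCA e' mulrA.
Qed.

Lemma rho_J x : J x -> J (valS (rho x)).
Proof.
by move=> Jx; apply: (reynolds_ideal hG hb iJ) => g Gg; exact: J_aut.
Qed.

(** Let u = s1 / a and u^k (1 - u c) in tB.  Then 1 - u c is congruent to 1 modulo
    the maximal ideals of B that contain u and to 0 modulo the others.  As s1 is
    invariant, G permutes the maximal ideals of either kind, so averaging
    (1 - u c) s2 over G does not change it modulo any of them.  Hence
    s = s1 + rho ((1 - u c) s2) is congruent to s2 where s1 vanishes and to s1
    elsewhere. *)
Lemma combine_generators (s1 s2 : S) : I s1 -> I s2 -> exists s, I s /\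
  forall n : set B, maximal_ideal n -> stable_contains n (valS s) ->
    stable_contains n (valS s1) /\ stable_contains n (valS s2).
Proof.
move=> /IJ J1 /IJ J2.
pose u : B := stable_of J1; pose u2 : B := stable_of J2.
have intB := @stable_ring_integral R J nR.
have [k [c [d e]]] := integral_split_power intB u d1 nt Jt.
have [m mE] : exists m : B, m = (1 - u * c) * u2 by exists ((1 - u * c) * u2).
have [w wE] : exists w : B, w = d * u2 by exists (d * u2).
exists (s1 + rho (stable_val m)); split.
  by apply/IJ; apply: (idealD iJ) => //; apply: rho_J; exact: stable_in.
move=> n mn ns; have iN := maximal_ideal_ideal mn; have pn := maximal_prime mn.
have absorb x y z : stable_contains n x -> J y -> a * z = x * y ->
    stable_contains n z.
  move=> [v [nv <-]] Jy ez; exists (stable_of Jy * v).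
  split; first exact: (idealM _ iN).
  by apply: (@stable_gen_inj _ J); rewrite stable_valM ez mulrC.
have iC : ideal (stable_contains n).
  split; first by exists 0; split=> //; exact: ideal0.
  move=> r _ _ [x [nx <-]] [y [ny <-]]; exists (stable_scalar J r * x + y).
  split; first by apply: (idealD iN) => //; exact: (idealM _ iN).
  by rewrite stable_valD stable_scalarM.
have [n1|nn1] := pselect (stable_contains n (valS s1)).
  split=> //; have nm : stable_contains n (valS (rho (stable_val m))).
    rewrite -[X in stable_contains n X](addKr (valS s1)) addrC -rmorphD.
    exact: (idealB iC).
  rewrite -(subKr (valS (rho (stable_val m))) (valS s2)); apply: (idealB iC) => //.
  apply: (reynolds_congr hG hb iC) => g Gg.
  (* Here g applied to (1 - u c) s2 differs from s2 by a multiple of s1. *)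
  have em : a * a * stable_val m = (a * a - valS s1 * stable_val c) * valS s2.
    rewrite -mulrA mE stable_valM mulrA; congr (_ * _).
    by rewrite stable_valB mulrBr stable_valM.
  have {em} := congr1 g em.
  rewrite !rmorphM rmorphB !rmorphM /= (invariantE s1 Gg) (invariantE s2 Gg) => em.
  have Jgc : J (g (stable_val c)) by apply: J_aut => //; exact: stable_in.
  have [h [Jh eh]] := stable_aut_gen Gg Jgc J2.
  have [h' [Jh' eh']] := stable_aut_gen Gg Jh (stable_genP J).
  apply: (absorb (valS s1) (- h')) => //; first exact: (idealN iJ).
  have nga : nzd R (g a) by apply: aut_nzd; exact: stable_gen_nzd.
  apply: (nga _ _); apply: (nga _ _).
  have -> : g a * (g a * (a * (g (stable_val m) - valS s2)))
    = a * (g a * g a * g (stable_val m)) - a * (g a * g a * valS s2) by ring.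
  rewrite em.
  have -> : g a * (g a * (valS s1 * - h')) = - valS s1 * g a * (g a * h') by ring.
  rewrite eh'.
  have -> : - valS s1 * g a * (h * a) = - valS s1 * a * (g a * h) by ring.
  by rewrite eh; ring.
suff nm : stable_contains n (valS (rho (stable_val m))).
  case: nn1; rewrite -[valS s1](addrK (valS (rho (stable_val m)))) -rmorphD.
  exact: (idealB iC).
apply: (reynolds_ideal hG hb iC) => g Gg.
(* Here u is a unit modulo n, and u^k times g applied to (1 - u c) s2 is still a
   multiple of t, because s1 and t are invariant. *)
have Jgm : J (g (stable_val m)) by apply: J_aut => //; exact: stable_in.
have Jgw : J (g (stable_val w)) by apply: J_aut => //; exact: stable_in.
have em : a ^+ k * (valS t * stable_val w) = valS s1 ^+ k * stable_val m.
  apply: (@stable_gen_inj _ J); rewrite -stable_scalarM.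
  have -> : stable_scalar J (valS t) * w = u ^+ k * m.
    by rewrite mE wE !mulrA e.
  rewrite mulrCA stable_valM [LHS]mulrA stable_valX; exact/esym/mulrA.
have {em} := congr1 g em.
rewrite !rmorphM !rmorphXn /= (invariantE s1 Gg) (invariantE t Gg) => em.
have [w' [Jw' ew']] := stable_aut_genX k Gg Jgw.
have eB : u ^+ k * stable_of Jgm = stable_scalar J (valS t) * stable_of Jw'.
  apply: stable_val_inj; apply: (@nzdX _ a k (stable_gen_nzd J)).
  apply: (@stable_gen_inj _ J); rewrite stable_scalarM.
  rewrite [LHS]mulrCA stable_valM [LHS]mulrA stable_valX /=.
  rewrite -mulrA -em; congr (_ * _); rewrite mulrCA ew'; ring.
have : n (u ^+ k * stable_of Jgm).
  rewrite eB mulrC; apply: (idealM _ iN); exact: (integral_jacobson intB mn Jt).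
case/(primeM pn) => [/(primeX pn) nu|nm]; last by exists (stable_of Jgm).
by case: nn1; exists u.
Qed.

(** The u in B for which there is s in I such that u vanishes at all maximal ideals
    where s / a does form an ideal, because generators can be combined.  It
    contains all s / a.  An equation of integral dependence of a over IR, divided
    by the power of a of its degree, shows that it contains 1; so some s / a is a
    unit of B. *)
Lemma exists_invariant_generator : icl (ext I) a ->
  exists s c, [/\ I s, J c & valS s * c = a * a].
Proof.
move=> aI; have I0 : I 0 by apply/IJ; exact: (ideal0 iJ).
pose dom : set B := [set u | exists s, I s /\
  forall n : set B, maximal_ideal n -> stable_contains n (valS s) -> n u].
have idom : ideal dom.
  split; first by exists 0; split=> // n mn _; exact: (ideal0 (maximal_ideal_ideal mn)).
  move=> x y z [s [Is hs]] [s' [Is' hs']].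
  have [r [Ir hr]] := combine_generators Is Is'; exists r; split=> // n mn nr.
  have [ns ns'] := hr n mn nr; have iN := maximal_ideal_ideal mn.
  by apply: (idealD iN); [apply: (idealM _ iN); exact: hs|exact: hs'].
have domI k : ext I k -> exists v, dom v /\ stable_val v = k.
  apply: (ideal_gen_sub (I := [set k | exists v, dom v /\ stable_val v = k])).
    split; first by exists 0; split=> //; exact: ideal0.
    move=> r _ _ [x [dx <-]] [y [dy <-]]; exists (stable_scalar J r * x + y).
    split; first by apply: (idealD idom) => //; exact: (idealM _ idom).
    by rewrite stable_valD stable_scalarM.
  move=> _ [s Is <-]; have Js := (IJ s).1 Is; exists (stable_of Js); split=> //.
  exists s; split=> // n mn [v [nv e]].
  by have -> : stable_of Js = v by exact: stable_val_inj.
(* Division by a^i of the elements of (IR)^i. *)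
have powI i k : ideal_pow (ext I) i k ->
    exists v, ((0 < i)%N -> dom v) /\ a ^+ i * stable_val v = a * k.
  elim: i k => [|i IH] k.
    by exists (stable_scalar J k); split=> //=; rewrite mul1r mulrC.
  apply: (ideal_mul_sub (K := [set k | exists v,
      ((0 < i.+1)%N -> dom v) /\ a ^+ i.+1 * stable_val v = a * k])).
    split; first by exists 0; split=> [_|]; [exact: ideal0|rewrite !mulr0].
    move=> r x y [v [dv ev]] [w [dw ew]]; exists (stable_scalar J r * v + w).
    split=> [_|].
      by apply: (idealD idom); [apply: (idealM _ idom); exact: dv|exact: dw].
    by rewrite stable_valD stable_scalarM mulrDr mulrCA ev ew; ring.
  move=> x y /domI[v [dv <-]] /IH[w [_ ew]]; exists (w * v); split=> [_|].
    exact: (idealM _ idom).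
  by rewrite exprS mulrAC stable_valM mulrAC [_ * a ^+ i]mulrC ew; ring.
have [f [mf ef wf]] := icl_poly nR (ext_ideal I) aI.
have [N Nf fN] := monic_size mf; rewrite Nf /= in wf.
have [v vP] := choice (fun i => powI (N - i)%N f`_i (wf i)).
have v1 : v N = 1.
  have [_] := vP N; rewrite subnn mul1r fN mulr1 => e.
  by apply: stable_val_inj.
(* The equation of a over IR, divided by a^N. *)
have sv : \sum_(i < N.+1) v i = 0.
  apply: stable_val_inj; apply: (@nzdX _ a N (stable_gen_nzd J)).
  rewrite -[stable_val 0]/(0 : R) mulr0 stable_val_sum mulr_sumr.
  transitivity (a * f.[a]); last by rewrite ef mulr0.
  rewrite horner_coef Nf mulr_sumr; apply: eq_bigr => i _.
  have [_ ev] := vP i.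
  have {1}-> : N = (i + (N - i))%N by have := ltn_ord i; lia.
  by rewrite exprD -mulrA ev; ring.
have [s [Is hs]] : dom 1.
  move: sv; rewrite big_ord_recr /= v1 => /eqP; rewrite addrC addr_eq0 => /eqP->.
  apply: (idealN idom); apply: (ideal_sum _ idom) => i _.
  by have [dv _] := vP i; apply: dv; rewrite subn_gt0.
have Js := (IJ s).1 Is.
have [n mn ns|c ec] := @jacobson_unit _ (stable_of Js : B).
  by apply: (maximal_proper mn); apply: hs => //; exists (stable_of Js).
exists s, (stable_val c); split=> //; first exact: stable_in.
by have := stable_valM (stable_of Js) c; rewrite ec.
Qed.

End InvariantGenerator.

(** * Invariants of Arf rings *)

Section InvariantArf.
Variables (R : comNzRingType) (G : set (ring_aut R)).
Hypothesis hG : finite_subgroup G.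
Variable b : R.
Hypothesis hb : b * (group_order G)%:R = 1.
Hypothesis arfR : arf_ring R.
Local Notation S := (invariant_ring G).
Local Notation valS := (@invariant_val R G).
Local Notation rho := (reynolds hG hb).

Lemma ideal_pow_ext (I : set S) n : ideal_pow (ext I) n `<=` ext (ideal_pow I n).
Proof.
elim: n => [|n IH].
  by move=> x _; rewrite -[x]mulr1; apply: (idealM _ (ext_ideal _)); exact: (@ext_val _ _ _ 1).
apply: ideal_mul_sub; first exact: ext_ideal.
move=> x y Ix /IH Iy; move: x Ix.
apply: (ideal_gen_sub (ideal_colon y (ext_ideal _))) => _ [s Is <-].
rewrite /mkset mulrC; move: y Iy.
apply: (ideal_gen_sub (ideal_colon (valS s) (ext_ideal _))) => _ [r Ir <-].
rewrite /mkset -rmorphM mulrC; apply: ext_val; exact: ideal_mul_in.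
Qed.

(** Applying the Reynolds operator to an equation of integral dependence over IR
    gives one over I. *)
Lemma icl_ext_contract (I : set S) s : integrally_closed_ideal I ->
  icl (ext I) (valS s) -> I s.
Proof.
move=> [iI cI] sI; have [[nR _ _] _ _] := arfR.
have [f [mf ef wf]] := icl_poly nR (ext_ideal I) sI.
have [N Nf fN] := monic_size mf; rewrite Nf /= in wf.
apply: cI.
have e : \sum_(i < N.+1) rho f`_i * s ^+ i = 0.
  transitivity (rho f.[valS s]); last by rewrite ef reynolds0.
  rewrite horner_coef Nf reynolds_sum; apply: eq_bigr => i _.
  by rewrite -rmorphXn [f`_i * _]mulrC reynoldsM mulrC.
have rho1 : rho 1 = 1 by rewrite -[RHS](reynolds_val hG hb).
have [N0|N0] := posnP N.
  have f0 : f`_0 = 1 by rewrite -fN N0.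
  move: e; rewrite N0 big_ord1 f0 rho1 mulr1 => /eqP.
  by rewrite oner_eq0.
exists N, (fun i => rho f`_(N - i)); split=> // [i iN|].
  apply: (ext_reynolds hG hb (ideal_pow_ideal I i)); apply: ideal_pow_ext.
  by have := wf (N - i)%N; rewrite subKn //; case/andP: iN.
rewrite -[RHS]e big_ord_recr /= fN rho1 mul1r addrC; congr (_ + _).
rewrite big_add1 big_mkord /= (reindex_inj rev_ord_inj) /=; apply: eq_bigr => i _.
by rewrite subnSK // subKn // ltnW.
Qed.

(** If L serves for x, its image under g serves for g x. *)
Lemma icl_ext_aut (I : set S) g x : G g -> icl (ext I) x -> icl (ext I) (g x).
Proof.
move=> Gg [L [iL [z Lz nz] xL]].
pose h := (g^-1)%g; have hK : cancel h g by exact: aut_inv_funK.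
have gK : cancel g h by exact: aut_funK.
exists (h @^-1` L); split.
- exact: ideal_preimage.
- by exists (g z); [rewrite /preimage /= aut_funK|exact: aut_nzd].
- move=> l Ll; rewrite -[l]hK -rmorphM; move: (xL _ Ll).
  apply: (ideal_mul_sub (K := g @^-1` ideal_mul (ext I) (h @^-1` L))).
    exact: ideal_preimage (ideal_mul_ideal _ _).
  move=> k y Ik Ly; rewrite /preimage /= rmorphM; apply: ideal_mul_in.
    exact: ext_aut.
  by rewrite /preimage /= aut_funK.
Qed.

(** Let J be the integral closure of IR, so that J meets S in I.  Some s in I
    satisfies J^2 = s J, and the Reynolds operator turns this into I^2 = s I. *)
Lemma invariant_principal_reduction (I : set S) : integrally_closed_ideal I ->
  (exists s, I s /\ nzd S s) -> has_principal_reduction I.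
Proof.
move=> cI [z [Iz nz]]; have [oR _ _] := arfR.
have [iI _] := cI; have iE := ext_ideal I.
have [nR _ d1 jR] := (one_dim_cm_semilocalP R).1 oR.
have [t nt Jt] : exists2 t : S, nzd R (valS t) &
    forall N : set R, maximal_ideal N -> N (valS t).
  have [y [ny Jy]] := jR; exists (norm hG y); first exact: norm_nzd.
  by move=> N mN; apply: norm_ideal; [exact: maximal_ideal_ideal|exact: Jy].
have zE : exists2 x, ext I x & nzd R x.
  by exists (valS z); [exact: ext_val|exact: (nzd_val hG hb)].
have [||a [Ja na aJ]] := arf_stable arfR (icl_integrally_closed nR iE zE).
- by move=> x; exact: icl_icl.
- by have [x Ex nx] := zE; exists x => //; exact: sub_icl.
pose J := StableIdeal (icl_ideal iE) Ja na aJ.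
have IJ s : I s <-> J (valS s).
  by split=> [Is|]; [apply: sub_icl => //; exact: ext_val|exact: icl_ext_contract].
have J_aut g x : G g -> J x -> J (g x) by exact: icl_ext_aut.
have [s [c [Is Jc esc]]] :=
  @exists_invariant_generator R G hG b hb nR d1 t nt Jt J J_aut I IJ Ja.
have sI x y : I x -> I y -> exists2 r, I r & s * r = x * y.
  move=> Ix Iy; have [r [Jr er]] := aJ _ _ ((IJ x).1 Ix) ((IJ y).1 Iy).
  have [q [Jq eq]] := aJ _ _ Jc Jr.
  have e : valS s * q = valS (x * y).
    rewrite rmorphM -er; apply: (na _ _).
    by rewrite [LHS]mulrCA eq [LHS]mulrA esc /=; ring.
  exists (rho q).
    by apply/IJ; apply: (rho_J hG hb J_aut).
  by rewrite -reynoldsM e reynolds_val.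
have pow1 : ideal_pow I 1 = I.
  apply/seteqP; split.
    by apply: ideal_mul_sub => // x y Ix _; rewrite mulrC; exact: idealM.
  by move=> x Ix; rewrite -[x]mulr1; exact: ideal_mul_in.
exists 1%N, s; split=> //; apply/seteqP; split; last first.
  by move=> _ [x Ix <-]; exact: ideal_mul_in.
rewrite pow1; apply: ideal_mul_sub.
  split=> [|x _ _ [r Ir <-] [r' Ir' <-]]; first by exists 0; [exact: ideal0|rewrite mulr0].
  by exists (x * r + r'); [case: iI => _; apply|ring].
move=> x y Ix; have : ideal_pow I 1 `<=` I by rewrite pow1.
move=> /[apply] Iy; have [r Ir e] := sI x y Ix Iy.
by exists r.
Qed.

Lemma integral_over_base_val (x y : S) (hx : nzd S x) (hx' : nzd R (valS x)) :
  integral_over_base (frac y hx) -> integral_over_base (frac (valS y) hx').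
Proof.
move=> /integral_fracP[f mf ef]; apply/integral_fracP.
exists (map_poly valS f); first exact: monic_map.
have sf : size (map_poly valS f) = size f.
  by rewrite size_map_poly_id0 // (monicP mf) rmorph1 oner_neq0.
rewrite -[RHS](rmorph0 valS) -ef rmorph_sum /homogeneous_eval sf.
by apply: eq_bigr => i _; rewrite coef_map !rmorphM !rmorphXn.
Qed.

Lemma arf_invariant : arf_ring S.
Proof.
have [oR _ arf2] := arfR; split.
- exact: (one_dim_cm_invariant hG hb oR).
- exact: invariant_principal_reduction.
- move=> x y z hx iy iz; have hx' := nzd_val hG hb oR hx.
  have [r _ er] := arf2 _ _ _ hx' (integral_over_base_val hx' iy)
    (integral_over_base_val hx' iz).
  have {}er : valS x * r = valS (y * z).
    have : tofrac (nzd R) (valS x * r) = tofrac _ (valS (y * z)).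
      by rewrite rmorphM /= er -tofrac_frac.
    by move/tofrac_eq => [u [nu]]; exact: nu.
  exists (rho r) => //.
  have -> : y * z = x * rho r by rewrite -reynoldsM er reynolds_val.
  by rewrite /tofrac; apply: Localization.frac_eq1; rewrite mulr1 mulrC.
Qed.

End InvariantArf.

Theorem theorem1p8 (R : comNzRingType) (hR : one_dim_cm_semilocal R)
    (hArf : arf_ring R) (G : set (ring_aut R)) (hG : finite_subgroup G)
    (hord : invertible ((group_order G)%:R : R)) :
  arf_ring (invariant_ring G).
Proof. by have [b hb] := hord; exact: (arf_invariant hG hb hArf). Qed.
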